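(* Let $X$ be a connected complex analytic manifold with universal covering $\widetilde{X}$, and let $G$ be a complex analytic Lie group. Given a group morphism $\varphi : \pi_1X\to\mathrm{Aut}(G)$, the map that sends a crossed morphism $\rho : \pi_1X\to G$ to the $\varphi$-twisted $G$-local system $$\mathcal{P}(\rho) := \pi_1X\,\backslash\,(\widetilde{X}\times G),$$ where $\pi_1X$ acts on the principal $G$-bundle $\widetilde{X}\times G$ via the $\pi_1X$-equivariant structure $\tau_f(\xi,h) := (f(\xi),\rho(f)\varphi_f(h))$, induces a bijection $$H^1_\varphi(\pi_1X,G)\simeq\{\varphi\text{-twisted }G\text{-local systems on }X\}/\text{isomorphism}.$$
   Context: $\pi_1X$ is identified with the automorphism group of the universal covering $\widetilde{X}\to X$, acting on $\widetilde{X}$ to the left. $\mathrm{Aut}(G)$ is the group of complex analytic group automorphisms of $G$, and $\varphi_f := \varphi(f)$. A crossed morphism $\rho : \pi_1X\to G$ (with respect to $\varphi$) is a map with $\rho(f_1\circ f_2) = \rho(f_1)\,\varphi_{f_1}(\rho(f_2))$ for all $f_1,f_2$; the set of these is $Z^1_\varphi(\pi_1X,G)$. $G$ acts on it by $(g\bullet\rho)(f) := g\,\rho(f)\,\varphi_f(g^{-1})$, and $H^1_\varphi(\pi_1X,G) := G\backslash Z^1_\varphi(\pi_1X,G)$. A group bundle on $X$ is a complex analytic manifold over $X$ whose fibres are complex Lie groups and which is locally on $X$ isomorphic to a product $U\times G$ by holomorphic maps that are Lie group isomorphisms fibrewise. For a group bundle $\mathcal{G}$, a (right) $\mathcal{G}$-torsor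 is a complex analytic manifold $\mathcal{P}$ over $X$ with a holomorphic map $\mathcal{P}\times_X\mathcal{G}\to\mathcal{P}$ over $X$, fibrewise a right group action, such that locally on $X$ there are $\mathcal{G}|_U$-equivariant isomorphisms $\mathcal{G}|_U\simeq\mathcal{P}|_U$ over $U$ ($\mathcal{G}|_U$ acting on itself by right translations). A flat structure on a (locally trivial, holomorphic) fibre bundle with typical fibre $F$ is an equivalence class of cocycles of locally constant transition functions $U_i\cap U_j\to\mathrm{Aut}(F)$ representing the bundle, two cocycles being equivalent if they are related by locally constant $\mathrm{Aut}(F)$-valued functions on the open sets of the cover; for a flat structure on a group bundle with typical fibre $G$, the transition functions and equivalences take values in the group automorphisms $\mathrm{Aut}(G)$. An isomorphism between flat bundles is flat if it is represented, in local trivialisations belonging to the flat structures, by locally constant functions $U_i\to\mathrm{Aut}(F)$. A flat group bundle is a group bundle $\mathcal{G}$ with a flat structure $\nabla_{\mathcal{G}}$. A flat torsor under $(\mathcal{G},\nabla_{\mathcal{G}})$ is a $\mathcal{G}$-torsor $\mathcal{P}$ with a flat structure $\nabla_{\mathcal{P}}$ on the fibre bundle $\mathcal{P}$ such that every point of $X$ has an open neighbourhood $U$ with a bundle isomorphism $\mathcal{G}|_U\simeq\mathcal{P}|_U$ that is both $\mathcal{G}|_U$-equivariant and flat. Isomorphisms of flat torsors are isomorphisms of $\mathcal{G}$-torsors that are flat. Given $\varphi$, let $\mathcal{G}_\varphi := \pi_1X\backslash(\widetilde{X}\times G)$, where $f\in\pi_1X$ acts by $(\xi,g)\mapsto(f(\xi),\varphi_f(g))$,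 with its canonical flat structure (induced by the product structure of $\widetilde{X}\times G$ via local sections of $\widetilde{X}\to X$). A $\varphi$-twisted $G$-local system on $X$ is a flat $\mathcal{G}_\varphi$-torsor, and isomorphisms of these are isomorphisms of flat $\mathcal{G}_\varphi$-torsors. $\mathcal{P}(\rho)$ carries the flat structure induced likewise by $\widetilde{X}\times G$ and the right $\mathcal{G}_\varphi$-action $[\xi,h]\cdot[\xi,g] := [\xi,hg]$. *)

(* Defs.v *)
From HB Require Import structures.
From mathcomp Require Import all_boot all_order all_algebra.
From mathcomp Require Import generic_quotient complex.
From mathcomp Require Import all_classical all_reals all_analysis.

Set Implicit Arguments.
Unset Strict Implicit.
Unset Printing Implicit Defensive.

Import Order.TTheory GRing.Theory Num.Theory.
Import numFieldNormedType.Exports.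

Local Open Scope classical_set_scope.
Local Open Scope ring_scope.
Local Open Scope quotient_scope.

Definition Cplx (R : realType) : numFieldType := R[i].

Section Manifolds.
Context {R : realType}.
Local Notation C := (Cplx R).

(* [differentiable] over the field [C] is complex Frechet differentiability;
   on an open subset of C^m it is equivalent to analyticity. *)
Definition holomorphic_near (m n : nat)
    (g : 'rV[C]_m -> 'rV[C]_n) (z : 'rV[C]_m) : Prop :=
  \forall w \near z, differentiable g w.

(* [chart_map] is total, but only its restriction to [chart_dom] matters. *)
Record chart (T : topologicalType) (n : nat) := Chart {
  chart_dom : set T;
  chart_map :> T -> 'rV[C]_n }.

Definition is_chart (T : topologicalType) (n : nat) (c : chart T n) : Prop :=
  [/\ open (chart_dom c),
      set_inj (chart_dom c) c,
      forall x, chart_dom c x -> {for x, continuous c} &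
      forall V, open V -> V `<=` chart_dom c -> open (c @` V)].

(* Around every point of the common domain, [d \o c^-1] is holomorphic. *)
Definition holomorphic_transition (T : topologicalType) (n : nat)
    (c d : chart T n) : Prop :=
  forall x, chart_dom c x -> chart_dom d x ->
    exists g : 'rV[C]_n -> 'rV[C]_n,
      holomorphic_near g (c x) /\ \forall y \near x, d y = g (c y).

(* The data of a complex manifold; the axioms are in [complex_manifold]. *)
Record charted_space := ChartedSpace {
  cs_top :> topologicalType;
  cs_dim : nat;
  cs_atlas : set (chart cs_top cs_dim) }.

Arguments cs_atlas : clear implicits.

(* Hausdorff of pure dimension; no countability axiom is imposed. *)
Definition complex_manifold (M : charted_space) : Prop :=
  [/\ hausdorff_space M,
      forall c, cs_atlas M c -> is_chart c,
      forall x : M, exists2 c, cs_atlas M c & chart_dom c x &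
      forall c d, cs_atlas M c -> cs_atlas M d -> holomorphic_transition c d].

Definition maximal_atlas (M : charted_space) : set (chart M (cs_dim M)) :=
  [set c | is_chart c /\ forall d, cs_atlas M d ->
             holomorphic_transition c d /\ holomorphic_transition d c].

Definition prod_chart (S T : topologicalType) (m n : nat)
    (c : chart S m) (d : chart T n) : chart (S * T)%type (m + n)%N :=
  Chart (chart_dom c `*` chart_dom d) (fun z => row_mx (c z.1) (d z.2)).

Definition prod_space (M N : charted_space) : charted_space :=
  @ChartedSpace (M * N)%type (cs_dim M + cs_dim N)%N
    [set e | exists c d, [/\ cs_atlas M c, cs_atlas N d & e = prod_chart c d]].

Definition holomorphic_at (M N : charted_space) (f : M -> N) (x : M) : Prop :=
  {for x, continuous f} /\
  forall c d, cs_atlas M c -> cs_atlas N d ->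
    chart_dom c x -> chart_dom d (f x) ->
    exists g : 'rV[C]_(cs_dim M) -> 'rV[C]_(cs_dim N),
      holomorphic_near g (c x) /\ \forall y \near x, d (f y) = g (c y).

Definition holomorphic (M N : charted_space) (f : M -> N) : Prop :=
  forall x, holomorphic_at f x.

(* Holomorphy of the restriction of [f] to [S], for [S] open or, more
   generally, a submanifold: local holomorphic extension to the ambient
   manifold. *)
Definition holomorphic_on (M N : charted_space) (S : set M) (f : M -> N) :
    Prop :=
  forall x, S x -> exists F : M -> N,
    holomorphic_at F x /\ \forall y \near x, S y -> F y = f y.

Definition biholomorphic_on (M N : charted_space) (S : set M) (T : set N)
    (f : M -> N) : Prop :=
  exists g : N -> M,
    [/\ holomorphic_on S f, holomorphic_on T g,
        forall x, S x -> T (f x) /\ g (f x) = x &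
        forall y, T y -> S (g y) /\ f (g y) = y].

End Manifolds.

Arguments charted_space R : clear implicits.
Arguments cs_atlas {R} M _ : rename.
Arguments maximal_atlas {R} M _.

Definition biholomorphic_aut (R : realType) (M : charted_space R) :
    set (M -> M) :=
  [set a | biholomorphic_on setT setT a].
Arguments biholomorphic_aut {R} M _.

#[short(type="topGroupType")]
HB.structure Definition TopGroup := {G of Topological G & Group G}.

Record lie_group (R : realType) := LieGroup {
  lg_carrier :> topGroupType;
  lg_dim : nat;
  lg_atlas : set (@chart R lg_carrier lg_dim) }.

Coercion lg_space (R : realType) (G : lie_group R) : charted_space R :=
  ChartedSpace (@lg_atlas R G).

Section LieGroups.
Context {R : realType}.

Definition complex_lie_group (G : lie_group R) : Prop :=
  [/\ complex_manifold G,
      holomorphic (M := prod_space G G) (N := G) (fun z => (z.1 * z.2)%g) &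
      holomorphic (M := G) (N := G) (fun g => (g^-1)%g)].

Definition lie_aut (G : lie_group R) : set (G -> G) :=
  [set a : G -> G | {morph a : x y / (x * y)%g} /\ biholomorphic_aut G a].

End LieGroups.
Arguments lie_aut {R} G _.

Definition nonempty_connected (T : topologicalType) : Prop :=
  [set: T] !=set0 /\ connected [set: T].

Section SimplyConnected.
Context (R : realType).

Definition path_connected (T : topologicalType) : Prop :=
  forall x y : T, exists gamma : R -> T,
    [/\ {within `[0, 1], continuous gamma}, gamma 0 = x & gamma 1 = y].

Definition loops_contractible (T : topologicalType) : Prop :=
  forall gamma : R -> T, {within `[0, 1], continuous gamma} ->
    gamma 0 = gamma 1 ->
    exists H : R * R -> T,
      [/\ {within [set` `[0, 1]] `*` [set` `[0, 1]], continuous H},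
          forall t, t \in `[0, 1] -> H (0, t) = gamma t,
          forall t, t \in `[0, 1] -> H (1, t) = gamma 0 &
          forall s, s \in `[0, 1] -> H (s, 0) = gamma 0 /\ H (s, 1) = gamma 0].

Definition simply_connected (T : topologicalType) : Prop :=
  [/\ [set: T] !=set0, path_connected T & loops_contractible T].

End SimplyConnected.

Section Coverings.
Context {R : realType} {Xt X : charted_space R}.

Definition evenly_covered (p : Xt -> X) (U : set X) : Prop :=
  open U /\ exists sheets : set (set Xt),
    [/\ p @^-1` U = \bigcup_(V in sheets) V,
        trivIset sheets id &
        forall V, sheets V -> open V /\ biholomorphic_on V U p].

Definition covering (p : Xt -> X) : Prop :=
  forall x, exists2 U, evenly_covered p U & U x.

Definition universal_covering (p : Xt -> X) : Prop :=
  [/\ complex_manifold Xt, covering p & simply_connected R Xt].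

Definition homeomorphism (S T : topologicalType) (f : S -> T) : Prop :=
  continuous f /\
  exists g : T -> S, [/\ continuous g, cancel f g & cancel g f].

Variable p : Xt -> X.

(* The automorphism group of the covering, i.e. pi_1 X. *)
Record deck := Deck {
  deck_fun :> Xt -> Xt;
  deck_homeo : homeomorphism deck_fun;
  deck_over : forall xi, p (deck_fun xi) = p xi }.

Lemma deck_comp_homeo (f1 f2 : deck) : homeomorphism (f1 \o f2).
Proof.
case: f1 f2 => [f1 [c1 [g1 [d1 fK1 gK1]]] _] [f2 [c2 [g2 [d2 fK2 gK2]]] _] /=.
split; first by move=> x; apply: continuous_comp; [exact: c2|exact: c1].
exists (g2 \o g1); split; last 2 first.
- exact: can_comp.
- exact: can_comp.
by move=> x; apply: continuous_comp; [exact: d1|exact: d2].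
Qed.

Lemma deck_comp_over (f1 f2 : deck) xi : p ((f1 \o f2) xi) = p xi.
Proof. by rewrite /= !deck_over. Qed.

Definition deck_comp (f1 f2 : deck) : deck :=
  Deck (deck_comp_homeo f1 f2) (deck_comp_over f1 f2).

End Coverings.

Section Cohomology.
Context {R : realType} {Xt X : charted_space R} {p : Xt -> X}.
Context {G : lie_group R}.
Variable phi : deck p -> G -> G.

Definition aut_morphism : Prop :=
  (forall f, lie_aut G (phi f)) /\
  (forall f1 f2, phi (deck_comp f1 f2) = phi f1 \o phi f2).

Definition Z1 : set (deck p -> G) :=
  [set rho | forall f1 f2,
     rho (deck_comp f1 f2) = (rho f1 * phi f1 (rho f2))%g].

Definition gauge (g : G) (rho : deck p -> G) : deck p -> G :=
  fun f => (g * rho f * phi f (g^-1))%g.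

Definition cohomology_class (rho : deck p -> G) : set (deck p -> G) :=
  range (gauge^~ rho).

(* The quotient of [Z1] by [G], as the set of orbits. *)
Definition H1 : set (set (deck p -> G)) := cohomology_class @` Z1.

End Cohomology.

(* A bundle over [X] with typical fibre [F], with its flat structure. The
   latter, an equivalence class of locally constant cocycles, is given by a
   representative: a set of local trivialisations [(U, t)], where [t] is the
   second component of an isomorphism [p^-1 U -> U * F]. *)
Record flat_bundle (R : realType) (X F : charted_space R) := FlatBundle {
  fb_total :> charted_space R;
  fb_proj : fb_total -> X;
  fb_flat : set (set X * (fb_total -> F)) }.

Arguments fb_proj {R X F} E _ : rename.
Arguments fb_flat {R X F} E _ : rename.

Section FlatBundles.
Context {R : realType} {X F : charted_space R}.

Definition fb_over (E : flat_bundle X F) (U : set X) : set E :=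
  fb_proj E @^-1` U.

Definition local_trivialization (E : flat_bundle X F) (U : set X)
    (t : E -> F) : Prop :=
  open U /\
  biholomorphic_on (N := prod_space X F) (fb_over U) (U `*` setT)
    (fun e : E => (fb_proj E e, t e)).

(* Over [U], the map [psi] over [X] is read in the trivialisations [t] and
   [t'] as a locally constant function with values in [A]. *)
Definition locally_constant_in (A : set (F -> F)) (E E' : flat_bundle X F)
    (U : set X) (t : E -> F) (t' : E' -> F) (psi : E -> E') : Prop :=
  forall x, U x -> exists2 a, A a &
    \forall y \near x, forall e, fb_proj E e = y -> t' (psi e) = a (t e).

(* [A] is the structure group of the cocycle. *)
Definition flat_structure (A : set (F -> F)) (E : flat_bundle X F) : Prop :=
  [/\ forall U t, fb_flat E (U, t) -> local_trivialization U t,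
      forall x, exists U t, fb_flat E (U, t) /\ U x &
      forall U t V s, fb_flat E (U, t) -> fb_flat E (V, s) ->
        locally_constant_in A (U `&` V) t s id].

Definition flat_map (E E' : flat_bundle X F) (U : set X) (psi : E -> E') :
    Prop :=
  forall V t V' t', fb_flat E (V, t) -> fb_flat E' (V', t') ->
    locally_constant_in (biholomorphic_aut F) (U `&` (V `&` V')) t t' psi.

Definition bundle_iso (E E' : flat_bundle X F) (U : set X) (psi : E -> E') :
    Prop :=
  biholomorphic_on (fb_over U) (fb_over U) psi /\
  forall e, fb_over U e -> fb_proj E' (psi e) = fb_proj E e.

End FlatBundles.

(* [gb_mul u v] is only meaningful for [u] and [v] in the same fibre. *)
Record flat_group_bundle_data (R : realType) (X : charted_space R)
    (G : lie_group R) := FlatGroupBundleData {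
  gb_bundle :> flat_bundle X G;
  gb_mul : gb_bundle -> gb_bundle -> gb_bundle }.

Section GroupBundles.
Context {R : realType} {X : charted_space R} {G : lie_group R}.
Variable GG : flat_group_bundle_data X G.
Local Notation pr := (fb_proj GG).

Definition fibre_unit (e : GG) : Prop :=
  forall u, pr u = pr e -> gb_mul e u = u /\ gb_mul u e = u.

Definition fibrewise_group : Prop :=
  [/\ forall u v, pr u = pr v -> pr (gb_mul u v) = pr u,
      forall u v w, pr u = pr v -> pr v = pr w ->
        gb_mul u (gb_mul v w) = gb_mul (gb_mul u v) w,
      forall x, exists2 e, pr e = x & fibre_unit e &
      forall u, exists v,
        [/\ pr v = pr u, fibre_unit (gb_mul u v) & fibre_unit (gb_mul v u)]].

Definition fibrewise_morphism (U : set X) (t : GG -> G) : Prop :=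
  forall u v, fb_over U u -> pr u = pr v -> t (gb_mul u v) = (t u * t v)%g.

Definition is_group_bundle : Prop :=
  [/\ complex_manifold GG, holomorphic pr, fibrewise_group &
      forall x, exists U t,
        [/\ U x, local_trivialization U t & fibrewise_morphism U t]].

Definition is_flat_group_bundle : Prop :=
  [/\ is_group_bundle, flat_structure (F := G) (lie_aut G) GG &
      forall U t, fb_flat GG (U, t) -> fibrewise_morphism U t].

(* [ts_act u v] is only meaningful for [u] and [v] over the same point. *)
Record flat_torsor_data := FlatTorsorData {
  ts_bundle :> flat_bundle X G;
  ts_act : ts_bundle -> GG -> ts_bundle }.

Definition fibrewise_action (P : flat_torsor_data) : Prop :=
  [/\ forall (u : P) v, fb_proj P u = pr v ->
        fb_proj P (ts_act u v) = fb_proj P u,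
      forall (u : P) e, fb_proj P u = pr e -> fibre_unit e -> ts_act u e = u &
      forall (u : P) v w, fb_proj P u = pr v -> pr v = pr w ->
        ts_act (ts_act u v) w = ts_act u (gb_mul v w)].

Definition torsor_trivialization (P : flat_torsor_data) (U : set X)
    (psi : GG -> P) : Prop :=
  [/\ open U, bundle_iso U psi &
      forall u v, fb_over U u -> pr u = pr v ->
        psi (gb_mul u v) = ts_act (psi u) v].

Definition is_torsor (P : flat_torsor_data) : Prop :=
  [/\ complex_manifold P,
      holomorphic (fb_proj P),
      holomorphic_on (M := prod_space P GG)
        [set z | fb_proj P z.1 = pr z.2] (fun z => ts_act z.1 z.2),
      fibrewise_action P &
      forall x, exists U psi, U x /\ @torsor_trivialization P U psi].

Definition is_flat_torsor (P : flat_torsor_data) : Prop :=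
  [/\ is_flat_group_bundle, is_torsor P,
      flat_structure (biholomorphic_aut G) P &
      forall x, exists U psi,
        [/\ U x, @torsor_trivialization P U psi & flat_map U psi]].

Definition flat_torsor_iso (P Q : flat_torsor_data) : Prop :=
  exists psi : P -> Q,
    [/\ bundle_iso setT psi,
        forall u v, fb_proj P u = pr v -> psi (ts_act u v) = ts_act (psi u) v &
        flat_map setT psi].

(* Predicates rather than elements of type [set _], whose universe is too
   small for [flat_torsor_data]. *)
Definition iso_class (P : flat_torsor_data) : flat_torsor_data -> Prop :=
  fun Q => is_flat_torsor Q /\ flat_torsor_iso P Q.

Definition iso_classes (A : flat_torsor_data -> Prop) : Prop :=
  exists2 P, is_flat_torsor P & A = iso_class P.

End GroupBundles.

Section OrbitSpace.
Context {T : topologicalType} {I : Type}.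
Variable tau : I -> T -> T.

Definition orbit_of (x : T) : set T := range (tau^~ x).

Definition orbit_space : Type := {A : set T | exists x, A = orbit_of x}.

Definition orbit_pi (x : T) : orbit_space :=
  exist _ (orbit_of x) (ex_intro _ x erefl).

Definition orbit_repr (A : orbit_space) : T := projT1 (cid (projT2 A)).

Lemma orbit_reprK : cancel orbit_repr orbit_pi.
Proof.
move=> [A hA]; rewrite /orbit_repr /orbit_pi /=.
by case: cid => x /= e; subst A; congr exist; exact: Prop_irrelevance.
Qed.

HB.instance Definition _ := gen_eqMixin orbit_space.
HB.instance Definition _ := gen_choiceMixin orbit_space.
HB.instance Definition _ := isQuotient.Build T orbit_space orbit_reprK.

Definition orbit_quotient : topologicalType := quotient_topology orbit_space.

Definition to_orbit (x : T) : orbit_quotient :=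
  \pi_(quotient_topology orbit_space) x.

End OrbitSpace.

Section Quotients.
Context {R : realType}.

(* The quotient topology, with the complex structure for which the projection
   is a local biholomorphism: [c] is a chart when [c \o to_orbit tau] is one
   locally. *)
Definition quotient_space (M : charted_space R) (I : Type)
    (tau : I -> M -> M) : charted_space R :=
  @ChartedSpace R (orbit_quotient tau) (cs_dim M)
    [set c | is_chart c /\ forall x : M, chart_dom c (to_orbit tau x) ->
       exists d, [/\ maximal_atlas M d, chart_dom d x &
                     \forall y \near x, c (to_orbit tau y) = d y]].

Context {Xt X : charted_space R} {p : Xt -> X} {G : lie_group R}.

Definition orb (tau : deck p -> prod_space Xt G -> prod_space Xt G)
    (xi : Xt) (g : G) : quotient_space tau :=
  to_orbit tau (xi, g).

(* The flat structure consists of the trivialisations [[s x, h] |-> h] for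
   the continuous local sections [s] of [p]. *)
Definition quotient_bundle
    (tau : deck p -> prod_space Xt G -> prod_space Xt G) : flat_bundle X G :=
  @FlatBundle R X G (quotient_space tau)
    (fun e => p (orbit_repr e).1)
    [set Ut | open Ut.1 /\ exists s : X -> Xt,
       forall x, Ut.1 x ->
         [/\ {for x, continuous s}, p (s x) = x &
             forall h, Ut.2 (orb tau (s x) h) = h]].

Variable phi : deck p -> G -> G.

Definition tau_phi (f : deck p) (z : prod_space Xt G) : prod_space Xt G :=
  (f z.1, phi f z.2).

Definition tau_rho (rho : deck p -> G) (f : deck p) (z : prod_space Xt G) :
    prod_space Xt G :=
  (f z.1, (rho f * phi f z.2)%g).

(* [xi, g] [xi, h] = [xi, g h]; [xget] returns its default value [u] when no
   such representatives exist, i.e. outside of the fibre product. *)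
Definition G_phi : flat_group_bundle_data X G :=
  @FlatGroupBundleData R X G (quotient_bundle tau_phi)
    (fun u v => xget u [set w | exists xi g h,
       [/\ u = orb tau_phi xi g, v = orb tau_phi xi h &
           w = orb tau_phi xi (g * h)%g]]).

Definition P_rho (rho : deck p -> G) : flat_torsor_data G_phi :=
  @FlatTorsorData R X G G_phi (quotient_bundle (tau_rho rho))
    (fun u v => xget u [set w | exists xi h g,
       [/\ u = orb (tau_rho rho) xi h, v = orb tau_phi xi g &
           w = orb (tau_rho rho) xi (h * g)%g]]).

End Quotients.

(* The library's [set_bij], which is not applicable for universe reasons. *)
Definition bijection_onto (S T : Type) (A : S -> Prop) (B : T -> Prop)
    (f : S -> T) : Prop :=
  [/\ forall x, A x -> B (f x),
      forall x y, A x -> A y -> f x = f y -> x = y &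
      forall y, B y -> exists2 x, A x & f x = y].

(* Main.v *)
Require Import Defs.
From mathcomp Require Import all_boot all_order all_algebra complex.
From mathcomp Require Import lra.
From mathcomp Require Import all_classical all_reals all_analysis.

(** A torsor with a flat structure is determined by its monodromy. Pull a flat
torsor [Q] back to the universal covering [Xt]. Locally constant coordinates
make the total space of [Q] a covering of [X], so, [Xt] being simply connected,
[Xt -> X] lifts to a flat section [s : Xt -> Q] ([flat_lift],
[exists_flat_section]). For every deck transformation [f], the map [s \o f] is
again a flat section. Two flat sections differ by a unique element of [G],
namely [s' xi = s xi * [xi, k]] with [k] independent of [xi], because [k] is
locally constant and [Xt] is connected ([flat_section_unique]). Hence
<<
  s xi = s (f xi) * [f xi, rho f]
>>
for a unique [rho f]; computing [s xi] through [f1 \o f2] in two ways shows that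
[rho] is a crossed morphism ([monodromy_Z1]). Replacing [s] by another flat
section [s * [xi, g^-1]] replaces [rho] by [gauge g rho], and every flat section
arises in this way ([monodromy_gauge], [monodromy_unique]).

The torsor [P(rho)] has the flat section [xi |-> [xi, 1]], with crossed morphism
[rho]. Its image under an isomorphism [P(rho) -> Q] is a flat section of [Q]
with crossed morphism [rho] ([iso_monodromy]). Conversely such a section [s]
yields the isomorphism [[xi, h] |-> s xi * [xi, h]] ([monodromy_iso]), which is
a left translation of [G] in suitable flat local coordinates, hence holomorphic
and flat. So the [rho] with [P(rho)] isomorphic to [Q] form exactly one orbit of
[G], and this is the bijection.

Three ingredients make this precise. The lifting theorem rests on unique lifting
of paths and of null homotopies, where existence and uniqueness are both
instances of a clopenness argument on the real line. Applied to [Xt -> X]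
itself, it shows that the deck group acts simply transitively on the fibres
([deck_free], [deck_transitive]). Finally [G_phi] and [P(rho)] are both
quotients of [Xt * G] by actions [(xi, g) |-> (f xi, a_f g)], and the complex
manifold and the flat structure are constructed for all actions of this form. *)

Set Implicit Arguments.
Unset Strict Implicit.
Unset Printing Implicit Defensive.

Import Order.TTheory GRing.Theory Num.Theory.
Import numFieldNormedType.Exports.

Local Open Scope classical_set_scope.
Local Open Scope ring_scope.

(** * Holomorphic maps between complex manifolds *)

Section NearDifferentiable.
Context {K : numFieldType}.

Lemma near_differentiable_comp (l m n : nat) (f : 'rV[K]_l -> 'rV[K]_m)
    (g : 'rV[K]_m -> 'rV[K]_n) z :
  (\forall w \near z, differentiable f w) ->
  (\forall w \near f z, differentiable g w) ->
  \forall w \near z, differentiable (g \o f) w.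
Proof.
move=> hf hg.
have cf : {for z, continuous f}.
  exact: differentiable_continuous (nbhs_singleton hf).
apply: filterS2 hf (cf _ hg) => w df dg.
exact: differentiable_comp.
Qed.

Lemma near_row_mx (m n : nat) (u : 'rV[K]_m) (v : 'rV[K]_n)
    (A : set 'rV[K]_(m + n)) :
  nbhs (row_mx u v) A ->
  exists B D, [/\ nbhs u B, nbhs v D &
    forall u' v', B u' -> D v' -> A (row_mx u' v')].
Proof.
case=> P hP PA.
exists [set u' | forall i j, P i (lshift n j) (u' i j)].
exists [set v' | forall i j, P i (rshift m j) (v' i j)]; split.
- exists (fun i j => P i (lshift n j)) => // i j.
  by have := hP i (lshift n j); rewrite row_mxEl.
- exists (fun i j => P i (rshift m j)) => // i j.
  by have := hP i (rshift m j); rewrite row_mxEr.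
move=> u' v' hu hv; apply: PA => i j.
by case: (split_ordP j) => k ->; rewrite ?row_mxEl ?row_mxEr.
Qed.

Lemma continuous_row_mx (T : topologicalType) (m n : nat) (f : T -> 'rV[K]_m)
    (g : T -> 'rV[K]_n) x :
  {for x, continuous f} -> {for x, continuous g} ->
  {for x, continuous (fun y => row_mx (f y) (g y))}.
Proof.
move=> cf cg A /near_row_mx[B [D [hB hD BDA]]].
have hfB : \forall y \near x, B (f y) by exact: cf hB.
have hgD : \forall y \near x, D (g y) by exact: cg hD.
by apply: filterS2 hfB hgD => y; exact: BDA.
Qed.

(** [row_mx] is the sum of the two linear inclusions, which are products with
block matrices. *)
Lemma near_differentiable_row_mx (l m n : nat) (f : 'rV[K]_l -> 'rV[K]_m)
    (g : 'rV[K]_l -> 'rV[K]_n) (z : 'rV[K]_l) :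
  (\forall w \near z, differentiable f w) ->
  (\forall w \near z, differentiable g w) ->
  \forall w \near z, differentiable (fun v : 'rV[K]_l => row_mx (f v) (g v)) w.
Proof.
move=> hf hg.
pose il : {linear 'rV[K]_m -> 'rV[K]_(m + n)} := mulmxr (row_mx 1%:M 0).
pose ir : {linear 'rV[K]_n -> 'rV[K]_(m + n)} := mulmxr (row_mx 0 1%:M).
have ilE : il = (fun u => row_mx u 0) :> (_ -> _).
  by apply/funext => u; rewrite /il /= mul_mx_row mulmx1 mulmx0.
have irE : ir = (fun u => row_mx 0 u) :> (_ -> _).
  by apply/funext => u; rewrite /ir /= mul_mx_row mulmx1 mulmx0.
have dl u : differentiable il u.
  apply: linear_differentiable; rewrite ilE => v.
  by apply: (@continuous_row_mx 'rV[K]_m _ _ id (fun _ => 0));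
    [move=> A|exact: cst_continuous].
have dr u : differentiable ir u.
  apply: linear_differentiable; rewrite irE => v.
  by apply: (@continuous_row_mx 'rV[K]_n _ _ (fun _ => 0) id);
    [exact: cst_continuous|move=> A].
apply: filterS2 hf hg => w df dg.
have -> : (fun v => row_mx (f v) (g v)) =
    ((il \o f) + (ir \o g) : 'rV[K]_l -> 'rV[K]_(m + n)).
  by rewrite ilE irE; apply/funext => v; rewrite fctE /= add_row_mx addr0 add0r.
by apply: differentiableD; exact: differentiable_comp.
Qed.

Lemma near_differentiable_lsubmx (m n : nat) (z : 'rV[K]_(m + n)) :
  \forall w \near z, differentiable (lsubmx : _ -> 'rV[K]_m) w.
Proof. by apply: filterE => w; exact: differentiable_lsubmx. Qed.

Lemma near_differentiable_rsubmx (m n : nat) (z : 'rV[K]_(m + n)) :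
  \forall w \near z, differentiable (rsubmx : _ -> 'rV[K]_n) w.
Proof. by apply: filterE => w; exact: differentiable_rsubmx. Qed.

Lemma near_differentiable_id (m : nat) (z : 'rV[K]_m) :
  \forall w \near z, differentiable (@id 'rV[K]_m) w.
Proof. by apply: filterE => w; apply: ex_diff. Qed.

Lemma near_differentiable_cst (m n : nat) (a : 'rV[K]_n) (z : 'rV[K]_m) :
  \forall w \near z, differentiable (fun _ : 'rV[K]_m => a) w.
Proof. by apply: filterE => w; exact: differentiable_cst. Qed.

Lemma near_differentiable_continuous (m n : nat) (f : 'rV[K]_m -> 'rV[K]_n)
    (z : 'rV[K]_m) :
  (\forall w \near z, differentiable f w) -> {for z, continuous f}.
Proof. by move=> /nbhs_singleton; exact: differentiable_continuous. Qed.

End NearDifferentiable.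

Section HolomorphicNear.
Context {R : realType}.
Local Notation C := (Cplx R).

Lemma holomorphic_near_comp (l m n : nat) (f : 'rV[C]_l -> 'rV[C]_m)
    (g : 'rV[C]_m -> 'rV[C]_n) z :
  holomorphic_near f z -> holomorphic_near g (f z) ->
  holomorphic_near (g \o f) z.
Proof. exact: near_differentiable_comp. Qed.

Lemma holomorphic_near_continuous (m n : nat) (f : 'rV[C]_m -> 'rV[C]_n) z :
  holomorphic_near f z -> {for z, continuous f}.
Proof. exact: near_differentiable_continuous. Qed.

Lemma holomorphic_near_id (m : nat) (z : 'rV[C]_m) : holomorphic_near id z.
Proof. exact: near_differentiable_id. Qed.

Lemma holomorphic_near_cst (m n : nat) (a : 'rV[C]_n) (z : 'rV[C]_m) :
  holomorphic_near (fun=> a) z.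
Proof. exact: near_differentiable_cst. Qed.

Lemma holomorphic_near_lsubmx (m n : nat) (z : 'rV[C]_(m + n)) :
  holomorphic_near lsubmx z.
Proof. exact: near_differentiable_lsubmx. Qed.

Lemma holomorphic_near_rsubmx (m n : nat) (z : 'rV[C]_(m + n)) :
  holomorphic_near rsubmx z.
Proof. exact: near_differentiable_rsubmx. Qed.

Lemma holomorphic_near_row_mx (l m n : nat) (f : 'rV[C]_l -> 'rV[C]_m)
    (g : 'rV[C]_l -> 'rV[C]_n) z :
  holomorphic_near f z -> holomorphic_near g z ->
  holomorphic_near (fun w => row_mx (f w) (g w)) z.
Proof. exact: near_differentiable_row_mx. Qed.

End HolomorphicNear.

Section ChartCalculus.
Context {R : realType}.
Local Notation C := (Cplx R).

(** The common shape of holomorphic transitions and of holomorphic maps read in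
charts: locally at [x], the vector [h] is a holomorphic function of [c]. *)
Definition holomorphic_in (T : topologicalType) (m n : nat)
    (c : T -> 'rV[C]_m) (h : T -> 'rV[C]_n) (x : T) : Prop :=
  exists g : 'rV[C]_m -> 'rV[C]_n,
    holomorphic_near g (c x) /\ \forall y \near x, h y = g (c y).

Lemma holomorphic_in_refl (T : topologicalType) (m : nat) (c : T -> 'rV[C]_m)
    (x : T) :
  holomorphic_in c c x.
Proof.
exists id; split; last exact: filterE.
exact: holomorphic_near_id.
Qed.

Lemma holomorphic_in_trans (T : topologicalType) (l m n : nat)
    (c : T -> 'rV[C]_l) (d : T -> 'rV[C]_m) (h : T -> 'rV[C]_n) (x : T) :
  holomorphic_in c d x -> holomorphic_in d h x -> holomorphic_in c h x.
Proof.
move=> [f [hf cd]] [g [hg dh]]; exists (g \o f); split.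
  apply: (holomorphic_near_comp hf).
  have <- := nbhs_singleton cd.
  exact: hg.
by apply: filterS2 cd dh => y /= <-.
Qed.

Lemma holomorphic_in_precomp (S T : topologicalType) (m n : nat) (f : S -> T)
    (c : T -> 'rV[C]_m) (h : T -> 'rV[C]_n) (x : S) :
  {for x, continuous f} -> holomorphic_in c h (f x) ->
  holomorphic_in (c \o f) (h \o f) x.
Proof. by move=> cf [g [hg ch]]; exists g; split=> //; exact: cf ch. Qed.

Lemma near_holomorphic_in (T : topologicalType) (m n : nat)
    (c : T -> 'rV[C]_m) (h k : T -> 'rV[C]_n) (x : T) :
  (\forall y \near x, h y = k y) -> holomorphic_in c h x ->
  holomorphic_in c k x.
Proof.
move=> hk [g [hg ch]]; exists g; split=> //.
by apply: filterS2 hk ch => y <-.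
Qed.

Lemma holomorphic_in_row_mx (T : topologicalType) (l m n : nat)
    (c : T -> 'rV[C]_l) (h : T -> 'rV[C]_m) (k : T -> 'rV[C]_n) (x : T) :
  holomorphic_in c h x -> holomorphic_in c k x ->
  holomorphic_in c (fun y => row_mx (h y) (k y)) x.
Proof.
move=> [f [hf cf]] [g [hg cg]]; exists (fun w => row_mx (f w) (g w)); split.
  exact: holomorphic_near_row_mx.
by apply: filterS2 cf cg => y -> ->.
Qed.

Lemma holomorphic_in_fst (S T : topologicalType) (m n : nat)
    (c : S -> 'rV[C]_m) (d : T -> 'rV[C]_n) (z : S * T) :
  holomorphic_in (fun z => row_mx (c z.1) (d z.2)) (c \o fst) z.
Proof.
exists lsubmx; split; first exact: holomorphic_near_lsubmx.
by apply: filterE => y; rewrite row_mxKl.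
Qed.

Lemma holomorphic_in_snd (S T : topologicalType) (m n : nat)
    (c : S -> 'rV[C]_m) (d : T -> 'rV[C]_n) (z : S * T) :
  holomorphic_in (fun z => row_mx (c z.1) (d z.2)) (d \o snd) z.
Proof.
exists rsubmx; split; first exact: holomorphic_near_rsubmx.
by apply: filterE => y; rewrite row_mxKr.
Qed.

End ChartCalculus.

Section HolomorphicMaps.
Context {R : realType}.
Implicit Types L M N : charted_space R.

Lemma sub_maximal_atlas M :
  complex_manifold M -> cs_atlas M `<=` maximal_atlas M.
Proof.
by case=> _ ch _ tr c Mc; split; [exact: ch|move=> d Md; split; exact: tr].
Qed.

(** Charts of the maximal atlas are compared through a chart of the atlas. *)
Lemma maximal_atlas_transition M c d :
  complex_manifold M -> maximal_atlas M c -> maximal_atlas M d ->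
  holomorphic_transition c d.
Proof.
move=> [_ _ cov _] [_ hc] [_ hd] x cx dx.
have [e Me ex] := cov x.
exact: holomorphic_in_trans (proj1 (hc _ Me) x cx ex) (proj2 (hd _ Me) x ex dx).
Qed.

Lemma exists_chart M (x : M) :
  complex_manifold M -> exists2 c, cs_atlas M c & chart_dom c x.
Proof. by case. Qed.

Lemma holomorphic_at_in M N (f : M -> N) x c d :
  complex_manifold M -> complex_manifold N -> holomorphic_at f x ->
  maximal_atlas M c -> maximal_atlas N d ->
  chart_dom c x -> chart_dom d (f x) -> holomorphic_in c (d \o f) x.
Proof.
move=> hM hN [cf hf] Mc Nd cx dx.
have [c0 Mc0 c0x] := exists_chart x hM.
have [d0 Nd0 d0x] := exists_chart (f x) hN.
have cc0 := proj1 (proj2 Mc _ Mc0) x cx c0x.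
have dd0 := proj2 (proj2 Nd _ Nd0) (f x) d0x dx.
apply: holomorphic_in_trans cc0 _.
apply: holomorphic_in_trans (hf _ _ Mc0 Nd0 c0x d0x) _.
exact: holomorphic_in_precomp.
Qed.

(** By compatibility, a single pair of charts suffices to test holomorphy. *)
Lemma in_holomorphic_at M N (f : M -> N) x c d :
  {for x, continuous f} -> maximal_atlas M c -> maximal_atlas N d ->
  chart_dom c x -> chart_dom d (f x) -> holomorphic_in c (d \o f) x ->
  holomorphic_at f x.
Proof.
move=> cf Mc Nd cx dx hf; split=> // c0 d0 Mc0 Nd0 c0x d0x.
have cc0 := proj2 (proj2 Mc _ Mc0) x c0x cx.
have dd0 := proj1 (proj2 Nd _ Nd0) (f x) dx d0x.
apply: holomorphic_in_trans cc0 _; apply: holomorphic_in_trans hf _.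
exact: holomorphic_in_precomp.
Qed.

Lemma near_holomorphic_at M N (f g : M -> N) x :
  (\forall y \near x, f y = g y) -> holomorphic_at f x -> holomorphic_at g x.
Proof.
move=> fg [cf hf]; have fgx := nbhs_singleton fg; split.
  move=> A; rewrite -fgx => /cf fA.
  by apply: filterS2 fg fA => y /= ->.
move=> c d Mc Nd cx; rewrite -fgx => dx.
apply: near_holomorphic_in (hf _ _ Mc Nd cx dx).
by apply: filterS fg => y /= ->.
Qed.

Lemma holomorphic_at_comp L M N (f : L -> M) (g : M -> N) x :
  complex_manifold M -> holomorphic_at f x -> holomorphic_at g (f x) ->
  holomorphic_at (g \o f) x.
Proof.
move=> hM [cf hf] [cg hg]; split; first exact: continuous_comp.
move=> c d Lc Nd cx dx; have [e Me ex] := exists_chart (f x) hM.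
apply: holomorphic_in_trans (hf _ _ Lc Me cx ex) _.
exact: holomorphic_in_precomp (hg _ _ Me Nd ex dx).
Qed.

Lemma holomorphic_at_id M x : complex_manifold M -> holomorphic_at (@id M) x.
Proof.
move=> hM; have [c Mc cx] := exists_chart x hM.
have Mc' := sub_maximal_atlas hM Mc.
by apply: (in_holomorphic_at _ Mc' Mc' cx cx) => //; exact: holomorphic_in_refl.
Qed.

Lemma holomorphic_at_cst M N (a : N) x : holomorphic_at (fun _ : M => a) x.
Proof.
split; first exact: cst_continuous.
move=> c d _ _ _ _; exists (fun _ => d a); split; last exact: filterE.
exact: holomorphic_near_cst.
Qed.

Lemma holomorphic_at_fst M N (z : prod_space M N) :
  complex_manifold M -> holomorphic_at (M := prod_space M N) (N := M) fst z.
Proof.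
move=> [_ _ _ tr]; split; first exact: cvg_fst.
move=> _ d [c1 [c2 [Mc1 Nc2 ->]]] Md [/= c1z c2z] dz.
apply: holomorphic_in_trans (holomorphic_in_fst _ _ _) _.
apply: (@holomorphic_in_precomp _ (M * N)%type M); first exact: cvg_fst.
exact: tr.
Qed.

Lemma holomorphic_at_snd M N (z : prod_space M N) :
  complex_manifold N -> holomorphic_at (M := prod_space M N) (N := N) snd z.
Proof.
move=> [_ _ _ tr]; split; first exact: cvg_snd.
move=> _ d [c1 [c2 [Mc1 Nc2 ->]]] Md [/= c1z c2z] dz.
apply: holomorphic_in_trans (holomorphic_in_snd _ _ _) _.
apply: (@holomorphic_in_precomp _ (M * N)%type N); first exact: cvg_snd.
exact: tr.
Qed.

Lemma holomorphic_at_pair L M N (f : L -> M) (g : L -> N) x :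
  holomorphic_at f x -> holomorphic_at g x ->
  holomorphic_at (N := prod_space M N) (fun y => (f y, g y)) x.
Proof.
move=> [cf hf] [cg hg]; split; first exact: cvg_pair.
move=> c _ Lc [d1 [d2 [Md1 Nd2 ->]]] cx [/= d1x d2x].
by apply: holomorphic_in_row_mx; [exact: hf|exact: hg].
Qed.

Lemma open_setX (S T : topologicalType) (A : set S) (B : set T) :
  open A -> open B -> open (A `*` B).
Proof.
move=> oA oB; rewrite openE => -[x y] [/= Ax By].
by exists (A, B) => //; split; exact: open_nbhs_nbhs.
Qed.

Lemma prod_chart_is_chart (S T : topologicalType) (m n : nat)
    (c : @chart R S m) (d : @chart R T n) :
  is_chart c -> is_chart d -> is_chart (prod_chart c d).
Proof.
move=> [oc ic cc pc] [od id cd pd]; split.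
- exact: open_setX.
- move=> [x y] [x' y'] /set_mem[/= cx dy] /set_mem[/= cx' dy'].
  move=> /eq_row_mx[e1 e2].
  by rewrite (ic x x') ?inE// (id y y') ?inE.
- move=> [x y] [/= cx dy]; apply: continuous_row_mx.
    by apply: continuous_comp; [exact: cvg_fst|exact: cc].
  by apply: continuous_comp; [exact: cvg_snd|exact: cd].
move=> V oV sV; rewrite openE => _ [[x y] Vxy <-] /=.
have [/= cx dy] := sV _ Vxy.
have [[A B] /= [nA nB] ABV] : nbhs (x, y) V by exact: open_nbhs_nbhs.
have oA : open (c @` (A° `&` chart_dom c)).
  by apply: pc; [apply: openI => //; exact: open_interior|exact: subIsetr].
have oB : open (d @` (B° `&` chart_dom d)).
  by apply: pd; [apply: openI => //; exact: open_interior|exact: subIsetr].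
have nA' : nbhs (c x) (c @` (A° `&` chart_dom c)).
  by apply: open_nbhs_nbhs; split=> //; exists x.
have nB' : nbhs (d y) (d @` (B° `&` chart_dom d)).
  by apply: open_nbhs_nbhs; split=> //; exists y.
have hl : \forall w \near row_mx (c x) (d y),
    (c @` (A° `&` chart_dom c)) (lsubmx w).
  have cl := holomorphic_near_continuous
    (@holomorphic_near_lsubmx R m n (row_mx (c x) (d y))).
  by apply: cl; rewrite row_mxKl.
have hr : \forall w \near row_mx (c x) (d y),
    (d @` (B° `&` chart_dom d)) (rsubmx w).
  have cr := holomorphic_near_continuous
    (@holomorphic_near_rsubmx R m n (row_mx (c x) (d y))).
  by apply: cr; rewrite row_mxKr.
apply: filterS2 hl hr => w [x' [Ax' _] ex'] [y' [By' _] ey'].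
exists (x', y'); last by rewrite /= ex' ey' hsubmxK.
by apply: ABV; split=> /=; exact: interior_subset.
Qed.

Lemma prod_hausdorff (S T : topologicalType) :
  hausdorff_space S -> hausdorff_space T -> hausdorff_space (S * T)%type.
Proof.
move=> hS hT [x y] [x' y'] cl; congr (_, _).
  apply: hS => A B xA xB.
  have [||[a b] [/= [Aa _] [Ba _]]] := cl (A `*` setT) (B `*` setT).
  - by exists (A, setT) => //=; split => //; exact: filterT.
  - by exists (B, setT) => //=; split => //; exact: filterT.
  by exists a.
apply: hT => A B xA xB.
have [||[a b] [/= [_ Aa] [_ Ba]]] := cl (setT `*` A) (setT `*` B).
- by exists (setT, A) => //=; split => //; exact: filterT.
- by exists (setT, B) => //=; split => //; exact: filterT.
by exists b.
Qed.

Lemma prod_manifold M N :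
  complex_manifold M -> complex_manifold N ->
  complex_manifold (prod_space M N).
Proof.
move=> [hM chM covM trM] [hN chN covN trN]; split.
- exact: prod_hausdorff.
- move=> _ [c [d [Mc Nd ->]]].
  by apply: prod_chart_is_chart; [exact: chM|exact: chN].
- move=> [x y]; have [c Mc cx] := covM x; have [d Nd dy] := covN y.
  by exists (prod_chart c d) => //; exists c, d.
move=> _ _ [c [d [Mc Nd ->]]] [c' [d' [Mc' Nd' ->]]].
move=> [x y] [/= cx dy] [/= cx' dy'].
suff : holomorphic_in (prod_chart c d) (prod_chart c' d') (x, y) by [].
apply: (@holomorphic_in_row_mx R (M * N)%type _ _ _ _ (c' \o fst) (d' \o snd)).
  apply: holomorphic_in_trans (holomorphic_in_fst c d (x, y)) _.
  apply: (@holomorphic_in_precomp _ (M * N)%type M); first exact: cvg_fst.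
  exact: trM.
apply: holomorphic_in_trans (holomorphic_in_snd c d (x, y)) _.
apply: (@holomorphic_in_precomp _ (M * N)%type N); first exact: cvg_snd.
exact: trN.
Qed.

Lemma holomorphic_on_open M N (S : set M) (f : M -> N) x :
  open S -> S x -> holomorphic_on S f -> holomorphic_at f x.
Proof.
move=> oS Sx /(_ x Sx)[F [hF FE]]; apply: near_holomorphic_at hF.
apply: filterS2 FE (open_nbhs_nbhs (conj oS Sx)) => y + Sy.
exact.
Qed.

Lemma holomorphic_at_on M N (S : set M) (f : M -> N) :
  (forall x, S x -> holomorphic_at f x) -> holomorphic_on S f.
Proof.
by move=> hf x Sx; exists f; split; [exact: hf|exact: filterE].
Qed.

End HolomorphicMaps.

Section BiholomorphicAut.
Context {R : realType}.
Implicit Types M N : charted_space R.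

Lemma holomorphic_on_setT M N (f : M -> N) :
  holomorphic_on setT f <-> holomorphic f.
Proof.
split=> hf; last by apply: holomorphic_at_on => x _; exact: hf.
by move=> x; apply: (holomorphic_on_open (S := setT)) => //; exact: openT.
Qed.

Lemma biholomorphic_autP M (a : M -> M) :
  biholomorphic_aut M a <->
  exists b, [/\ holomorphic a, holomorphic b, cancel a b & cancel b a].
Proof.
split.
  move=> [b [/holomorphic_on_setT ha /holomorphic_on_setT hb aK bK]].
  by exists b; split=> // x; [have [] := aK x|have [] := bK x].
move=> [b [ha hb aK bK]].
by exists b; split; [exact/holomorphic_on_setT..| |].
Qed.

Lemma biholomorphic_aut_id M :
  complex_manifold M -> biholomorphic_aut M id.
Proof.
by move=> hM; apply/biholomorphic_autP; exists id; split=> // x;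
  exact: holomorphic_at_id.
Qed.

Lemma biholomorphic_aut_comp M (a b : M -> M) :
  complex_manifold M -> biholomorphic_aut M a -> biholomorphic_aut M b ->
  biholomorphic_aut M (a \o b).
Proof.
move=> hM /biholomorphic_autP[a' [ha ha' aK a'K]].
move=> /biholomorphic_autP[b' [hb hb' bK b'K]].
apply/biholomorphic_autP; exists (b' \o a'); split.
- by move=> x; apply: holomorphic_at_comp.
- by move=> x; apply: holomorphic_at_comp.
- exact: can_comp.
- exact: can_comp.
Qed.

Lemma biholomorphic_aut_inv M (a : M -> M) :
  biholomorphic_aut M a ->
  exists b, [/\ biholomorphic_aut M b, cancel a b & cancel b a].
Proof.
move=> /biholomorphic_autP[b [ha hb aK bK]]; exists b; split=> //.
by apply/biholomorphic_autP; exists a.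
Qed.

Lemma biholomorphic_aut_inj M (a : M -> M) :
  biholomorphic_aut M a -> injective a.
Proof. by move=> /biholomorphic_aut_inv[b [_ aK _]]; exact: can_inj aK. Qed.

Definition transport_chart (S T : topologicalType) (n : nat)
    (c : @chart R T n) (b : S -> T) : chart S n :=
  Chart (b @^-1` chart_dom c) (c \o b).

(** A chart moved by an automorphism need not be in the atlas any more, but it
stays in the maximal atlas. This gives the charts of a quotient at all points of
an orbit. *)
Lemma transport_maximal_atlas M (a b : M -> M) c :
  complex_manifold M -> holomorphic a -> holomorphic b ->
  cancel a b -> cancel b a ->
  maximal_atlas M c -> maximal_atlas M (transport_chart c b).
Proof.
move=> hM ha hb aK bK Mc; have [oc ic cc pc] := proj1 Mc.
have ca : continuous a by move=> x; case: (ha x).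
have cb : continuous b by move=> x; case: (hb x).
split.
  split.
  - by apply: open_comp => // x _; exact: cb.
  - move=> x y /set_mem/= cx /set_mem/= cy e; apply: (can_inj bK).
    by apply: ic => //; rewrite inE.
  - by move=> x cx; apply: continuous_comp; [exact: cb|exact: cc].
  move=> V oV sV; rewrite (_ : _ @` V = c @` (a @^-1` V)).
    apply: pc; first by apply: open_comp => // x _; exact: ca.
    by move=> x /= /sV /=; rewrite aK.
  rewrite eqEsubset; split=> [_ [x Vx <-]|_ [x Vx <-]] /=.
    by exists (b x) => //=; rewrite bK.
  by exists (a x) => //=; rewrite aK.
move=> d /(sub_maximal_atlas hM) Md; split=> x.
  move=> /= cx dx.
  have := holomorphic_at_in hM hM (ha (b x)) Mc Md cx; rewrite bK.
  move=> /(_ dx)/(holomorphic_in_precomp (cb x)).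
  by apply: near_holomorphic_in; apply: filterE => y /=; rewrite bK.
by move=> dx /= cx; apply: (holomorphic_at_in hM hM (hb x) Md Mc).
Qed.

End BiholomorphicAut.

(** * Lifting flat sections over simply connected spaces *)

(** If the truth of [P] is locally independent of the point, then both [P] and
its complement are open. *)
Lemma connected_propagate (T : topologicalType) (P : set T) :
  connected [set: T] ->
  (forall x : T, exists2 B : set T, nbhs x B &
    forall y z, B y -> B z -> P y -> P z) ->
  forall x y, P x -> P y.
Proof.
move=> cT hP x y Px; suff -> : P = setT by [].
apply: cT; first by exists x.
- exists P; last by rewrite setTI.
  rewrite openE => z Pz; have [B nB BP] := hP z.
  have Bz := nbhs_singleton nB.
  by apply: filterS nB => w Bw; exact: (BP z w).
- exists P; last by rewrite setTI.
  rewrite -[P]setCK; apply: open_closedC; rewrite openE => z nPz.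
  have [B nB BP] := hP z.
  rewrite /interior; apply: filterS (nB) => w Bw Pw; apply: nPz.
  by apply: (BP w z) => //; exact: nbhs_singleton nB.
Qed.

Section RealLine.
Context {R : realType}.
Implicit Types a b c t : R.

Lemma connected_real : connected [set: R].
Proof. by apply/connected_intervalP. Qed.

(** Composition with the retraction onto [[0, b]] turns a path on a segment into
a map on the whole line, where neighbourhoods are two-sided. For [b <= 0] the
retraction is constant, so that lifts over [[0, b]] make sense for all [b]. *)
Definition clamp b t : R := Num.max 0 (Num.min b t).

Lemma clamp_continuous b : continuous (clamp b).
Proof.
move=> t; apply: (@continuous_max R R (fun=> 0) (fun t => Num.min b t)).
  exact: cst_continuous.
apply: (@continuous_min R R (fun=> b) id); first exact: cst_continuous.
by move=> A.
Qed.

Lemma clamp_itv b t : 0 <= b -> 0 <= clamp b t <= b.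
Proof. by move=> ?; rewrite /clamp maxEle minEle; do 2?case: ifP; lra. Qed.

Lemma clamp_id b t : 0 <= t <= b -> clamp b t = t.
Proof. by move=> ?; rewrite /clamp maxEle minEle; do 2?case: ifP; lra. Qed.

Lemma clamp_le0 b t : b <= 0 -> clamp b t = 0.
Proof. by move=> ?; rewrite /clamp maxEle minEle; do 2?case: ifP; lra. Qed.

Lemma clamp0 b : clamp b 0 = 0.
Proof. by rewrite /clamp maxEle minEle; do 2?case: ifP; lra. Qed.

Lemma clamp_clamp b c t : b <= Num.max 0 c -> clamp c (clamp b t) = clamp b t.
Proof. by rewrite /clamp !maxEle !minEle; do 5?case: ifP; lra. Qed.

Definition glue (T : Type) c (f g : R -> T) t : T :=
  if t <= c then f t else g t.

(** At [t = c] both hypotheses apply, so a property that holds near [c] along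
each piece holds near [c] along the glued function. *)
Lemma near_glue (T : Type) c (f g : R -> T) (Q : R -> T -> Prop) t :
  (t <= c -> \forall u \near t, Q u (f u)) ->
  (c <= t -> \forall u \near t, Q u (g u)) ->
  \forall u \near t, Q u (glue c f g u).
Proof.
move=> Qf Qg; rewrite /glue; case: (ltgtP t c) => [tc|ct|tc].
- by apply: filterS2 (lt_nbhsl tc) (Qf (ltW tc)) => u uc; rewrite ltW.
- apply: filterS2 (lt_nbhsr ct) (Qg (ltW ct)) => u.
  by rewrite ltNge => /negbTE->.
- have [Qf' Qg'] : (\forall u \near t, Q u (f u)) /\
      (\forall u \near t, Q u (g u)).
    by rewrite tc in Qf Qg *; split; [exact: Qf|exact: Qg].
  by apply: filterS2 Qf' Qg' => u ? ?; case: ifP.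
Qed.

Lemma glueE (T : Type) c (f g : R -> T) t :
  f c = g c -> (t <= c -> glue c f g t = f t) * (c <= t -> glue c f g t = g t).
Proof.
rewrite /glue => fg; split=> [->//|ct]; case: ifP => // tc.
by have -> : t = c by apply/le_anti; rewrite tc.
Qed.

Lemma glue_continuous (T : topologicalType) c (f g : R -> T) :
  f c = g c -> continuous f -> continuous g -> continuous (glue c f g).
Proof.
move=> fg cf cg t A nA.
apply: (near_glue (Q := fun _ => A)) => h.
  by apply: cf; rewrite -(glueE _ fg).1.
by apply: cg; rewrite -(glueE _ fg).2.
Qed.

Lemma within_clamp_continuous (T : topologicalType) (f : R -> T) :
  {within `[0, 1], continuous f} -> continuous (f \o clamp 1).
Proof.
move=> /subspace_continuousP cf t A nA.
have it : `[0, 1]%classic (clamp 1 t) by rewrite /= in_itv /= clamp_itv.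
have h : \forall u \near t, `[0, 1]%classic (clamp 1 u) -> A (f (clamp 1 u)).
  exact: clamp_continuous (cf _ it _ nA).
by apply: filterS h => u; apply; rewrite /= in_itv /= clamp_itv.
Qed.

Lemma within_clamp2_continuous (T : topologicalType) (f : R * R -> T) :
  {within [set` `[0, 1]] `*` [set` `[0, 1]], continuous f} ->
  continuous (fun z : R * R => f (clamp 1 z.1, clamp 1 z.2)).
Proof.
move=> /subspace_continuousP cf z A nA.
have iz (w : R * R) :
    ([set` `[0, 1]] `*` [set` `[0, 1]]) (clamp 1 w.1, clamp 1 w.2).
  by split; rewrite /= in_itv /= clamp_itv.
have c1 : {for z, continuous (fun z : R * R => clamp 1 z.1)}.
  by apply: continuous_comp; [exact: cvg_fst|exact: clamp_continuous].
have c2 : {for z, continuous (fun z : R * R => clamp 1 z.2)}.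
  by apply: continuous_comp; [exact: cvg_snd|exact: clamp_continuous].
have cz : {for z, continuous (fun z : R * R => (clamp 1 z.1, clamp 1 z.2))}.
  by apply: (cvg_pair (G := nbhs (clamp 1 z.1)) (H := nbhs (clamp 1 z.2)));
    [exact: c1|exact: c2].
have h : \forall w \near z, ([set` `[0, 1]] `*` [set` `[0, 1]])
    (clamp 1 w.1, clamp 1 w.2) -> A (f (clamp 1 w.1, clamp 1 w.2)).
  exact: cz (cf _ (iz z) _ nA).
by apply: filterS h => w; apply; exact: iz.
Qed.

End RealLine.

(** A covering space, presented by its locally constant coordinates. This form
covers at once the sheets of a topological covering, with [F] the set of all
sheets, and the flat structure of a bundle with fibre [F]. In [ls_compat] the
neighbourhood of [q e] may depend on [e]: infinitely many sheets need not have a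
common one. *)
Record local_system (X : topologicalType) (E F : Type) (q : E -> X)
    (triv : set X -> (E -> F) -> Prop) : Prop := LocalSystem {
  ls_open : forall U t, triv U t -> open U;
  ls_cover : forall x, exists U t, triv U t /\ U x;
  ls_inj : forall U t e e', triv U t -> U (q e) -> q e = q e' -> t e = t e' ->
    e = e';
  ls_transport : forall U t e y, triv U t -> U (q e) -> U y ->
    exists2 e', q e' = y & t e' = t e;
  ls_compat : forall U t V s e, triv U t -> triv V s -> U (q e) -> V (q e) ->
    \forall y \near q e, forall e', q e' = y -> t e' = t e -> s e' = s e }.

Section LocalSystem.
Context {X : topologicalType} {E F : Type} {q : E -> X}.
Context {triv : set X -> (E -> F) -> Prop}.
Hypothesis LS : local_system q triv.

Definition flat_at (T : topologicalType) (sigma : T -> E) (x : T) : Prop :=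
  forall U t, triv U t -> U (q (sigma x)) ->
    \forall y \near x, t (sigma y) = t (sigma x).

(** Flatness may be tested in a single trivialisation, by compatibility. *)
Lemma in_flat_at (T : topologicalType) (sigma : T -> E) (x : T) U t :
  {for x, continuous (q \o sigma)} -> triv U t -> U (q (sigma x)) ->
  (\forall y \near x, t (sigma y) = t (sigma x)) -> flat_at sigma x.
Proof.
move=> cq Ut Ux tE V s Vs Vx.
have h := cq _ (ls_compat LS Ut Vs Ux Vx).
by apply: filterS2 tE h => y tE; exact.
Qed.

Lemma near_triv (T : topologicalType) (f : T -> X) (x : T) U t :
  {for x, continuous f} -> triv U t -> U (f x) -> \forall y \near x, U (f y).
Proof.
move=> cf Ut Ux.
by apply: cf; apply: open_nbhs_nbhs; split=> //; exact: ls_open LS _ _ Ut.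
Qed.

Lemma flat_at_comp (S T : topologicalType) (g : S -> T) (sigma : T -> E) x :
  {for x, continuous g} -> flat_at sigma (g x) -> flat_at (sigma \o g) x.
Proof. by move=> cg fs U t Ut Ux; exact: cg (fs U t Ut Ux). Qed.

Lemma flat_at_cst (T : topologicalType) (e : E) (x : T) :
  flat_at (fun _ => e) x.
Proof. by move=> U t _ _; exact: filterE. Qed.

(** Near each point, coincidence of two flat lifts is coincidence of their
constant coordinates. *)
Lemma flat_unique (T : topologicalType) (sigma sigma' : T -> E) :
  connected [set: T] -> continuous (q \o sigma) ->
  q \o sigma =1 q \o sigma' ->
  (forall x, flat_at sigma x) -> (forall x, flat_at sigma' x) ->
  forall x y, sigma x = sigma' x -> sigma y = sigma' y.
Proof.
move=> cT cq qE fs fs'.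
apply: (connected_propagate (P := fun x => sigma x = sigma' x)) => // x.
have [U [t [Ut Ux]]] := ls_cover LS (q (sigma x)).
exists [set y | [/\ t (sigma y) = t (sigma x), t (sigma' y) = t (sigma' x) &
                   U (q (sigma y))]].
  have Ux' : U (q (sigma' x)) by have /= <- := qE x.
  by apply: filterS3 (fs x _ _ Ut Ux) (fs' x _ _ Ut Ux')
    (near_triv (cq x) Ut Ux) => y.
move=> y z [e1 e2 _] [e3 e4 Uz] e.
apply: (ls_inj LS Ut) => //; first exact: qE.
by rewrite e3 -e1 e e2 e4.
Qed.

Section Paths.
Context {R : realType}.

(** Existence of a lift over [[0, b]] is locally independent of [b]: over an
interval on which [f] stays in one trivialisation, a lift extends with constant
coordinate. Hence it holds for [b = 1], as it does for [b = 0]. *)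
Lemma path_lift (f : R -> X) (e0 : E) :
  continuous f -> q e0 = f 0 ->
  exists sigma : R -> E, [/\ q \o sigma =1 f \o clamp 1, sigma 0 = e0 &
    forall t, flat_at sigma t].
Proof.
move=> cf e00.
pose P (b : R) := exists sigma : R -> E, [/\ q \o sigma =1 f \o clamp b,
  sigma 0 = e0 & forall t, flat_at sigma t].
have P0 : P 0.
  exists (fun=> e0); split=> // [t|t]; last exact: flat_at_cst.
  by rewrite /= clamp_le0.
have PS c b : b <= Num.max 0 c -> P c -> P b.
  move=> bc [sigma [qs s0 fs]]; exists (sigma \o clamp b); split.
  - by move=> t; have /= -> := qs (clamp b t); rewrite clamp_clamp.
  - by rewrite /= clamp0.
  - by move=> t; apply: flat_at_comp; [exact: clamp_continuous|exact: fs].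
suff : P 1 by [].
apply: (connected_propagate (P := P) connected_real _ 1 P0) => b0.
have [U [t [Ut Ub0]]] := ls_cover LS (f b0).
have [r r0 Br] : exists2 r, 0 < r & forall u, `|b0 - u| < r -> U (f u).
  by have [r /= r0 Br] := near_triv (cf b0) Ut Ub0; exists r.
exists [set u | `|b0 - u| < r]; first by exists r.
move=> b c /= Bb Bc Pb.
have [cb|bc] := leP c (Num.max 0 b); first exact: PS Pb.
(* For [b < 0] the lift starts at [0], which lies between [b] and [c]. *)
pose b' := Num.max 0 b.
have [b'0 bb' b'c] : [/\ 0 <= b', b <= b' & b' < c].
  by rewrite /b'; split=> //; rewrite maxEle; case: ifP; lra.
have Ufc u : b' <= u <= c -> U (f u).
  by move=> ubc; apply: Br; move: Bb Bc; rewrite !ltr_distlC; lra.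
have [sigma [qs s0 fs]] : P b'.
  by apply: PS Pb; rewrite /b' maxEle; case: ifP; lra.
have qsb' : q (sigma b') = f b'.
  by have /= -> := qs b'; rewrite clamp_id// lexx b'0.
have cbE u : b' <= clamp c (Num.max b' u) <= c.
  have cb' : clamp c (Num.max b' u) = Num.min c (Num.max b' u).
    by rewrite /clamp max_r // le_min (le_trans b'0 (ltW b'c)) le_max b'0.
  by rewrite cb' le_min ge_min lexx le_max lexx (ltW b'c).
have /choice[g gP] : forall u, exists e,
    q e = f (clamp c (Num.max b' u)) /\ t e = t (sigma b').
  move=> u; have [||e] := @ls_transport _ _ _ _ _ LS U t (sigma b')
    (f (clamp c (Num.max b' u))) Ut.
  - by rewrite qsb'; apply: Ufc; rewrite lexx ltW.
  - exact: Ufc.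
  by exists e.
have gb' : sigma b' = g b'.
  apply: (ls_inj LS Ut); last by rewrite (gP b').2.
    by rewrite qsb'; apply: Ufc; rewrite lexx ltW.
  by rewrite (gP b').1 qsb' maxxx clamp_id // b'0 ltW.
have gE u := glueE u gb'.
have qglue : q \o glue b' sigma g =1 f \o clamp c.
  move=> u /=; have [ub|bu] := leP u b'.
    rewrite (gE _).1//; have /= -> := qs u; congr (f _).
    by rewrite /clamp !min_r // (le_trans ub) // ltW.
  by rewrite (gE _).2 ?ltW// (gP u).1 max_r// ltW.
exists (glue b' sigma g); split=> //.
  by rewrite (gE _).1.
move=> u.
have cq : {for u, continuous (q \o glue b' sigma g)}.
  rewrite (_ : q \o glue b' sigma g = f \o clamp c); last exact/funext.
  by apply: continuous_comp; [exact: clamp_continuous|exact: cf].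
have [ub|bu] := ltP u b'.
  move=> V s Vs; rewrite (gE _).1 ?ltW// => Vu.
  apply: (near_glue (Q := fun _ e => s e = s (sigma u))) => [_|bu].
    exact: fs _ _ _ Vs Vu.
  by have := le_lt_trans bu ub; rewrite ltxx.
apply: (in_flat_at cq Ut).
  by rewrite (gE _).2// (gP u).1; exact: Ufc.
rewrite (gE _).2// (gP u).2.
apply: (near_glue (Q := fun _ e => t e = t (sigma b'))) => [ub|_].
  have -> : u = b' by apply/le_anti; rewrite ub bu.
  by apply: (fs b' U t Ut); rewrite qsb'; apply: Ufc; rewrite lexx ltW.
by apply: filterE => v; rewrite (gP v).2.
Qed.

(** Lift each path [t |-> f (s, t)] from [e0]. That the lifts vary flatly with
[s] propagates along [t], since in a box inside one trivialisation the
coordinates are constant along the vertical segments. *)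
Lemma homotopy_lift (f : R * R -> X) (e0 : E) :
  continuous f -> (forall s t, f (s, clamp 1 t) = f (s, t)) ->
  (forall s, f (s, 0) = q e0) ->
  exists sigma : R * R -> E, [/\ q \o sigma =1 f, forall s, sigma (s, 0) = e0 &
    forall z, flat_at sigma z].
Proof.
move=> cf fc f0.
have cfs s : continuous (fun t => f (s, t)).
  move=> t; apply: (@continuous_comp R (R * R)%type X (fun t => (s, t)) f).
    by apply: (cvg_pair (G := nbhs s) (H := nbhs t)); [exact: cvg_cst|].
  exact: cf.
have /choice[sg sgP] : forall s, exists sg : R -> E,
    [/\ q \o sg =1 (fun t => f (s, t)), sg 0 = e0 & forall t, flat_at sg t].
  move=> s; have [|sg [qs s0 fs]] := @path_lift (fun t => f (s, t)) e0 (cfs s).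
    by rewrite f0.
  by exists sg; split=> // t; have /= -> := qs t; rewrite fc.
pose sigma (z : R * R) := sg z.1 z.2.
have qs : q \o sigma =1 f by move=> [s t]; have [h _ _] := sgP s; exact: h.
exists sigma; split=> //; first by move=> s; have [_ ? _] := sgP s.
move=> [s0 t0].
pose A (t : R) := flat_at (fun s => sigma (s, t)) s0.
have cq : continuous (q \o sigma) by rewrite (funext qs).
(* The vertical segment from [t] to [t'] is run through by [c] below. *)
have box t1 : exists U u (r : R), [/\ triv U u, 0 < r,
    U (q (sigma (s0, t1))) &
    \forall s \near s0, forall t t', `|t1 - t| < r -> `|t1 - t'| < r ->
      [/\ U (q (sigma (s, t))) & u (sigma (s, t)) = u (sigma (s, t'))]].
  have [U [u [Uu U1]]] := ls_cover LS (q (sigma (s0, t1))).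
  have [[B D] /= [nB [r /= r0 rD]] BDU] := near_triv (cq (s0, t1)) Uu U1.
  exists U, u, r; split=> //; apply: filterS nB => s Bs t t' rt rt'.
  have Ust v : `|t1 - v| < r -> U (q (sigma (s, v))).
    by move=> rv; apply: (BDU (s, v)); split=> //=; exact: rD.
  split; first exact: Ust.
  wlog tt' : t t' rt rt' / t <= t'.
    by move=> wl; have [/wl->//|/ltW/wl->] := leP t t'.
  pose c v := t + clamp (t' - t) (v - t).
  have cE v : t <= c v <= t'.
    have : 0 <= clamp (t' - t) (v - t) <= t' - t by apply: clamp_itv; lra.
    by rewrite /c; lra.
  have cc : continuous c.
    move=> v; apply: cvgD; first exact: cvg_cst.
    apply: (@continuous_comp R R R (fun v => v - t));
      last exact: clamp_continuous.
    by apply: cvgB; [exact: cvg_id|exact: cvg_cst].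
  have Uc v : U (q (sigma (s, c v))).
    by apply: Ust; move: (cE v) rt rt'; rewrite !ltr_distlC; lra.
  have [_ _ fs] := sgP s.
  have ct : c t = t by rewrite /c subrr clamp0 addr0.
  have ct' : c t' = t' by rewrite /c clamp_id; lra.
  suff : u (sigma (s, c t)) = u (sigma (s, c t')) by rewrite ct ct'.
  apply: (connected_propagate (P := fun v => u (sigma (s, c t)) =
    u (sigma (s, c v))) connected_real _ t' erefl) => v.
  exists [set w | u (sigma (s, c w)) = u (sigma (s, c v))].
    have fcv : flat_at (sg s \o c) v := flat_at_comp (cc v) (fs (c v)).
    exact: fcv U u Uu (Uc v).
  by move=> w w' /= -> -> ->.
have At t : A t.
  apply: (connected_propagate (P := A) connected_real _ (x := 0) t) => [t1|];
      last first.
    move=> U u Uu; rewrite {1}/sigma /= => _; apply: filterE => s.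
    by rewrite /sigma /=; have [_ -> _] := sgP s; have [_ -> _] := sgP s0.
  have [U [u [r [Uu r0 U1 nr]]]] := box t1.
  exists [set t | `|t1 - t| < r]; first by exists r.
  move=> v w /= rv rw Av.
  have [Uv _] := nbhs_singleton nr v v rv rv.
  have [Uw vw] := nbhs_singleton nr w v rw rv.
  apply: (in_flat_at (t := u) (U := U)) => //.
    rewrite (_ : _ \o _ = f \o (fun s => (s, w))); last first.
      by apply/funext => s; exact: qs.
    apply: continuous_comp; last exact: cf.
    by apply: (cvg_pair (G := nbhs s0) (H := nbhs w)); [|exact: cvg_cst].
  apply: filterS2 (Av _ _ Uu Uv) nr => s vE h.
  by rewrite vw -vE; have [] := h w v rw rv.
have [U [u [r [Uu r0 U1 nr]]]] := box t0.
apply: (in_flat_at (cq _) Uu U1).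
have ru : \forall t \near t0, `|t0 - t| < r by exists r.
exists ([set s | (forall t t', `|t0 - t| < r -> `|t0 - t'| < r ->
      [/\ U (q (sigma (s, t))) & u (sigma (s, t)) = u (sigma (s, t'))]) /\
      u (sigma (s, t0)) = u (sigma (s0, t0))], [set t | `|t0 - t| < r]).
  by split=> //; exact: filterI nr (At t0 U u Uu U1).
move=> [s t] [/= [h <-] rt]; have [] := h t t0 rt => //.
by rewrite subrr normr0.
Qed.

End Paths.
End LocalSystem.

Section FlatLift.
Context {R : realType} {T X : topologicalType} {E F : Type} {q : E -> X}.
Context {triv : set X -> (E -> F) -> Prop}.
Hypothesis LS : local_system q triv.
Variable f : T -> X.
Hypothesis cf : continuous f.

Local Notation flat := (@flat_at X E F q triv R).

Definition parallel_transport (x : T) (e : E) (y : T) (e' : E) : Prop :=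
  exists (gamma : R -> T) (sigma : R -> E),
    [/\ continuous gamma, q \o sigma =1 f \o gamma & forall t, flat sigma t] /\
    [/\ gamma 0 = x, gamma 1 = y, sigma 0 = e & sigma 1 = e'].

Lemma parallel_transport_sym x e y e' :
  parallel_transport x e y e' -> parallel_transport y e' x e.
Proof.
move=> [g [s [[cg qs fs] [g0 g1 s0 s1]]]].
have cr : continuous (fun t : R => 1 - t).
  by move=> t; apply: cvgB; [exact: cvg_cst|exact: cvg_id].
exists (fun t => g (1 - t)), (fun t => s (1 - t)); split; split.
- move=> t; apply: (@continuous_comp R R T (fun t => 1 - t) g);
    [exact: cr|exact: cg].
- by move=> t; exact: qs.
- move=> t; apply: (@flat_at_comp X E F q triv R R (fun t => 1 - t) s);
    [exact: cr|exact: fs].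
- by rewrite subr0.
- by rewrite subrr.
- by rewrite subr0.
- by rewrite subrr.
Qed.

Lemma parallel_transport_trans x e y e' z e'' :
  parallel_transport x e y e' -> parallel_transport y e' z e'' ->
  parallel_transport x e z e''.
Proof.
move=> [g [s [[cg qs fs] [g0 g1 s0 s1]]]] [h [r [[ch qr fr] [h0 h1 r0 r1]]]].
have c1 : continuous (fun t : R => 2 * t) by move=> t; exact: mulrl_continuous.
have c2 : continuous (fun t : R => 2 * t - 1).
  by move=> t; apply: cvgB; [exact: mulrl_continuous|exact: cvg_cst].
have e1 : 2 * 2^-1 = 1 :> R by rewrite divff// pnatr_eq0.
have e2 : 2 * 2^-1 - 1 = 0 :> R by rewrite e1 subrr.
have ghE t := @glueE R _ 2^-1 (fun t => g (2 * t)) (fun t => h (2 * t - 1)) t.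
have srE t := @glueE R _ 2^-1 (fun t => s (2 * t)) (fun t => r (2 * t - 1)) t.
rewrite /= e2 e1 g1 h0 in ghE; rewrite /= e2 e1 s1 r0 in srE.
have {}ghE t := ghE t erefl; have {}srE t := srE t erefl.
exists (glue 2^-1 (fun t => g (2 * t)) (fun t => h (2 * t - 1))).
exists (glue 2^-1 (fun t => s (2 * t)) (fun t => r (2 * t - 1))).
split; split.
- apply: glue_continuous; first by rewrite e2 e1 g1 h0.
    move=> t; apply: (@continuous_comp R R T (fun t => 2 * t) g);
      [exact: c1|exact: cg].
  move=> t; apply: (@continuous_comp R R T (fun t => 2 * t - 1) h);
    [exact: c2|exact: ch].
- move=> t; rewrite /= /glue; case: ifP => _; [exact: qs|exact: qr].
- move=> t U u Uu Ut.
  apply: (near_glue (Q := fun _ v => u v = u (glue 2^-1 (fun t => s (2 * t))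
    (fun t => r (2 * t - 1)) t))) => h2.
    rewrite (srE t).1 // in Ut *.
    by apply: (@flat_at_comp X E F q triv R R (fun t => 2 * t) s) Uu Ut;
      [exact: c1|exact: fs].
  rewrite (srE t).2 // in Ut *.
  by apply: (@flat_at_comp X E F q triv R R (fun t => 2 * t - 1) r) Uu Ut;
    [exact: c2|exact: fr].
- by rewrite (ghE 0).1 ?mulr0//; lra.
- by rewrite (ghE 1).2 ?mulr1; [rewrite -h1; congr h; lra|lra].
- by rewrite (srE 0).1 ?mulr0//; lra.
- by rewrite (srE 1).2 ?mulr1; [rewrite -r1; congr r; lra|lra].
Qed.

(** Lift a null homotopy of the loop to the square: the sides [s = 1], [t = 0]
and [t = 1] are constant, hence so are their lifts, and the lift of the side
[s = 0] closes up. *)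
Lemma parallel_transport_loop x e e' :
  loops_contractible R T -> parallel_transport x e x e' -> e = e'.
Proof.
move=> cT [g [s [[cg qs fs] [g0 g1 s0 s1]]]].
have [|H [cH H0 H1 HS]] := cT g (continuous_subspaceT cg).
  by rewrite g0 g1.
pose K (z : R * R) := f (H (clamp 1 z.1, clamp 1 z.2)).
have i01 (t : R) : clamp 1 t \in `[0, 1] by rewrite in_itv /= clamp_itv.
have c0 : clamp 1 0 = 0 :> R by rewrite clamp0.
have c1 : clamp 1 1 = 1 :> R by rewrite clamp_id// ler01 lexx.
have cc (t : R) : clamp 1 (clamp 1 t) = clamp 1 t.
  by rewrite clamp_id// clamp_itv.
have HSx a : H (clamp 1 a, 0) = x /\ H (clamp 1 a, 1) = x.
  by have [-> ->] := HS _ (i01 a); rewrite g0.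
have qe : q e = f x by rewrite -s0 -g0; exact: qs.
have [|||L [KL L0 fL]] := homotopy_lift LS (f := K) (e0 := e).
- move=> z; apply: (@continuous_comp (R * R)%type T X _ f); last exact: cf.
  exact: within_clamp2_continuous cH _.
- by move=> a t; rewrite /K /= cc.
- by move=> a; rewrite /K /= c0 (HSx a).1.
have ca (a : R) : continuous (fun t : R => (a, t)).
  by move=> t; apply: (cvg_pair (G := nbhs a) (H := nbhs t)); [exact: cvg_cst|].
have cb (b : R) : continuous (fun a : R => (a, b)).
  by move=> t; apply: (cvg_pair (G := nbhs t) (H := nbhs b)); [|exact: cvg_cst].
have Lg t : s (clamp 1 t) = L (0, t).
  apply: (flat_unique LS (sigma := s \o clamp 1)
    (sigma' := L \o (fun t => (0, t))) (@connected_real R) _ _ _ _ (x := 0)).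
  - rewrite (_ : q \o _ = f \o (g \o clamp 1)); last first.
      by apply/funext => u; exact: qs.
    move=> u; apply: continuous_comp; last exact: cf.
    by apply: continuous_comp; [exact: clamp_continuous|exact: cg].
  - move=> u; have /= -> := qs (clamp 1 u); have /= -> := KL (0, u).
    by rewrite /K /= c0 H0.
  - by move=> u; apply: flat_at_comp; [exact: clamp_continuous|exact: fs].
  - by move=> u; apply: flat_at_comp; [exact: ca|exact: fL].
  - by rewrite /= c0 L0.
have L1 : L (1, 1) = e.
  apply: (flat_unique LS (sigma := L \o (fun t => (1, t))) (sigma' := fun=> e)
    (@connected_real R) _ _ _ _ (x := 0)) => //.
  - rewrite (_ : q \o _ = fun=> f x); first by move=> u; exact: cst_continuous.
    apply/funext => u; have /= -> := KL (1, u).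
    by rewrite /K /= c1 H1 ?g0.
  - by move=> u /=; have /= -> := KL (1, u); rewrite /K /= c1 H1 // g0 qe.
  - by move=> u; apply: flat_at_comp; [exact: ca|exact: fL].
  - by move=> u; exact: flat_at_cst.
  - exact: L0.
have qL u : q (L (u, 1)) = f x.
  by have /= -> := KL (u, 1); rewrite /K /= c1 (HSx u).2.
have L01 : L (0, 1) = L (1, 1).
  apply: (flat_unique LS (sigma := L \o (fun a => (a, 1)))
    (sigma' := fun=> L (1, 1)) (@connected_real R) _ _ _ _ (x := 1)) => //.
  - rewrite (_ : q \o _ = fun=> f x); first by move=> u; exact: cst_continuous.
    by apply/funext => u; exact: qL.
  - by move=> u /=; rewrite !qL.
  - by move=> u; apply: flat_at_comp; [exact: cb|exact: fL].
  - by move=> u; exact: flat_at_cst.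
by rewrite -L1 -L01 -Lg c1 s1.
Qed.

Lemma exists_parallel_transport x e y :
  path_connected R T -> q e = f x -> exists e', parallel_transport x e y e'.
Proof.
move=> pT qe; have [g [cg g0 g1]] := pT x y.
have c0 : clamp 1 0 = 0 :> R by rewrite clamp0.
have c1 : clamp 1 1 = 1 :> R by rewrite clamp_id// ler01 lexx.
have cgc := within_clamp_continuous cg.
have [||s [qs s0 fs]] := path_lift LS (f := f \o (g \o clamp 1)) (e0 := e).
- by move=> t; apply: continuous_comp; [exact: cgc|exact: cf].
- by rewrite /= c0 g0.
exists (s 1), (g \o clamp 1), s; split; split=> //=.
- move=> t; have /= -> := qs t.
  by rewrite [clamp 1 (clamp 1 t)]clamp_id // clamp_itv.
- by rewrite c0.
- by rewrite c1.
Qed.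

End FlatLift.

Definition locally_path_connected (R : realType) (T : topologicalType) : Prop :=
  forall (x : T) (W : set T), nbhs x W -> \forall y \near x,
    exists gamma : R -> T, [/\ continuous gamma, gamma 0 = x, gamma 1 = y &
      forall t, W (gamma t)].

(** By contractibility of loops, parallel transport from [x0] does not depend on
the path. Local paths inside one trivialisation show that the resulting section
is flat. *)
Lemma flat_lift (R : realType) (T X : topologicalType) (E F : Type)
    (q : E -> X) (triv : set X -> (E -> F) -> Prop) (f : T -> X) x0 e0 :
  simply_connected R T -> locally_path_connected R T ->
  local_system q triv -> continuous f -> q e0 = f x0 ->
  exists s : T -> E, [/\ q \o s =1 f, s x0 = e0 &
    forall x, flat_at (q := q) (triv := triv) s x].
Proof.
move=> [_ pT cT] lT LS cf q0.
pose PT := @parallel_transport R T X E F q triv f.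
have /choice[s sP] : forall x, exists e, PT x0 e0 x e.
  by move=> x; exact: exists_parallel_transport.
have sU x e : PT x0 e0 x e -> e = s x.
  move=> xe; apply: (parallel_transport_loop LS cf (x := x) cT).
  exact: parallel_transport_trans (parallel_transport_sym xe) (sP x).
have qs : q \o s =1 f.
  move=> x; have [g [r [[_ qr _] [_ g1 _ r1]]]] := sP x.
  by have /= := qr 1; rewrite g1 r1.
exists s; split=> //.
  apply/esym/sU; exists (fun=> x0), (fun=> e0); split; split=> //.
  - exact: cst_continuous.
  - by move=> t; exact: flat_at_cst.
move=> x U t Ut Ux; have /= qsx := qs x.
rewrite qsx in Ux.
apply: filterS (lT x _ (near_triv LS (cf x) Ut Ux)) => y [g [cg g0 g1 Ug]].
have /choice[r rP] : forall v, exists e, q e = f (g v) /\ t e = t (s x).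
  move=> v; have [||e] := ls_transport LS (e := s x) (y := f (g v)) Ut.
  - by rewrite qsx.
  - exact: Ug.
  by exists e.
have rx : r 0 = s x.
  apply: (ls_inj LS Ut); last by rewrite (rP 0).2.
    by rewrite (rP 0).1 g0.
  by rewrite (rP 0).1 g0 qsx.
have cfg : continuous (f \o g).
  by move=> v; apply: continuous_comp; [exact: cg|exact: cf].
suff <- : r 1 = s y by rewrite (rP 1).2.
apply: sU; apply: parallel_transport_trans (sP x) _.
exists g, r; split; split=> //.
- by move=> v; rewrite /= (rP v).1.
move=> v; apply: (in_flat_at LS _ Ut).
- rewrite (_ : q \o r = f \o g); first exact: cfg.
  by apply/funext => w; exact: (rP w).1.
- by rewrite (rP v).1; exact: Ug.
- by apply: filterE => w; rewrite !(rP _).2.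
Qed.

Lemma path_connected_connected (R : realType) (T : topologicalType) :
  path_connected R T -> connected [set: T].
Proof.
move=> pT B [b Bb] [C oC] + [D cD]; rewrite !setTI => BC BD.
apply/seteqP; split=> // x _.
have [g [cg g0 g1]] := pT b x; have {}cg := within_clamp_continuous cg.
have : B ((g \o clamp 1) 1).
  apply: (connected_propagate (P := B \o (g \o clamp 1)) (@connected_real R) _
    (x := 0)).
    move=> t; have [Bt|nBt] := pselect (B (g (clamp 1 t))).
      exists ((g \o clamp 1) @^-1` B) => //.
      by apply: cg; apply: open_nbhs_nbhs; split=> //; rewrite BC.
    exists ((g \o clamp 1) @^-1` (~` B)).
      apply: cg; apply: open_nbhs_nbhs; split=> //.
      by rewrite BD; exact: closed_openC.
    by move=> u v /= nBu.
  by rewrite /= clamp0 g0.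
by rewrite /= clamp_id ?g1 // ler01 lexx.
Qed.

(** Balls are star-shaped. The embedding [iota] of the real unit interval is
needed because the scalars are complex whereas paths have a real parameter. *)
Lemma rV_locally_path_connected (R : realType) (K : numFieldType)
    (iota : R -> K) (n : nat) :
  continuous iota -> iota 0 = 0 -> iota 1 = 1 ->
  (forall t, 0 <= t <= 1 -> `|iota t| <= 1) ->
  locally_path_connected R 'rV[K]_n.
Proof.
move=> ci i0 i1 in1 x W /nbhs_normP[r /= r0 rW].
have : \forall y \near x, `|x - y| < r.
  by apply/nbhs_normP; exists r.
apply: filterS => y xy.
pose g (t : R) := x + iota (clamp 1 t) *: (y - x).
exists g; split.
- move=> t; apply: cvgD; first exact: cvg_cst.
  apply: (@continuous_comp R K 'rV[K]_n (iota \o clamp 1) ( *:%R ^~ (y - x))).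
    by apply: continuous_comp; [exact: clamp_continuous|exact: ci].
  exact: scalel_continuous.
- by rewrite /g clamp0 i0 scale0r addr0.
- by rewrite /g clamp_id ?ler01 ?lexx// i1 scale1r subrKC.
move=> t; apply: rW => /=; rewrite /g opprD addrA subrr add0r normrN normrZ.
apply: le_lt_trans xy; rewrite -(distrC y x) -[leRHS]mul1r.
by apply: ler_wpM2r => //; apply: in1; exact: clamp_itv.
Qed.

Section ManifoldPaths.
Context {R : realType}.

Lemma real_complex_continuous : continuous (fun t : R => (t%:C)%C : Cplx R).
Proof.
move=> t; apply/(@cvgrPdist_lt (Cplx R) _ R).
move=> e e0.
have : 0 < complex.Re e by move: e0; rewrite ltcE => /andP[].
move=> e0'; near=> u.
have -> : `|(t%:C)%C - (u%:C)%C| = (`|t - u|%:C)%C :> Cplx R.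
  by rewrite -rmorphB /= normc_def /= expr0n /= addr0 sqrtr_sqr.
(* A positive complex number is real. *)
have eE : e = ((complex.Re e)%:C)%C.
  by move: e0; rewrite ltcE; case: (e) => a b /= /andP[/eqP -> _].
rewrite eE ltcR; near: u.
by exists (complex.Re e).
Unshelve. all: by end_near. Qed.

Lemma chart_locally_path_connected (T : topologicalType) (n : nat)
    (c : @chart R T n) (x : T) (W : set T) :
  is_chart c -> chart_dom c x -> nbhs x W ->
  \forall y \near x, exists gamma : R -> T,
    [/\ continuous gamma, gamma 0 = x, gamma 1 = y & forall t, W (gamma t)].
Proof.
move=> hc cx nW; have [oc ic cc pc] := hc.
pose V := chart_dom c `&` W°.
have oV : open V by apply: openI => //; exact: open_interior.
have Vx : V x by split.
have ncV : nbhs (c x) (c @` V).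
  apply: open_nbhs_nbhs; split; last by exists x.
  by apply: pc => //; exact: subIsetl.
have lC : locally_path_connected R 'rV[Cplx R]_n.
  apply: (rV_locally_path_connected real_complex_continuous) => //.
  move=> t /andP[t0 t1].
  by rewrite normc_def /= expr0n /= addr0 sqrtr_sqr lecR ger0_norm.
have h := cc _ cx _ (lC _ _ ncV).
have nV : \forall y \near x, V y by exact: open_nbhs_nbhs.
have {}h : \forall y \near x, exists gamma : R -> 'rV[Cplx R]_n,
    [/\ continuous gamma, gamma 0 = c x, gamma 1 = c y &
      forall t, (c @` V) (gamma t)] := h.
apply: filterS2 h nV => y [d [cd d0 d1 dV]] Vy.
have /choice[g gP] : forall t, exists v, V v /\ c v = d t.
  by move=> t; have [v Vv vE] := dV t; exists v.
have gE t v : V v -> c v = d t -> g t = v.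
  move=> [cv _] vE; have [[cg _] gtE] := gP t.
  by apply: ic; rewrite ?inE // gtE.
exists g; split.
- move=> t A nA.
  have : nbhs (d t) (c @` (A° `&` V)).
    apply: open_nbhs_nbhs; split.
      by apply: pc; [apply: openI => //; exact: open_interior|move=> v [_ []]].
    by exists (g t); [split=> //; exact: (gP t).1|exact: (gP t).2].
  move=> nd.
  have hd : \forall u \near t, (c @` (A° `&` V)) (d u) by exact: cd nd.
  have : \forall u \near t, A (g u).
    apply: filterS hd => u [v [Av Vv] vE].
    by rewrite (gE u v) //; exact: interior_subset.
  by [].
- exact: gE.
- exact: gE.
by move=> t; have [[_ Wt] _] := gP t; exact: interior_subset.
Qed.

Lemma manifold_locally_path_connected (M : charted_space R) :
  complex_manifold M -> locally_path_connected R M.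
Proof.
move=> [_ ch cov _] x W nW; have [c Mc cx] := cov x.
exact: chart_locally_path_connected (ch c Mc) cx nW.
Qed.

End ManifoldPaths.

(** * Covering maps and deck transformations *)

Section Coverings.
Context {R : realType} {X Xt : charted_space R} {p : Xt -> X}.

Record sheet (V : set Xt) (U : set X) (g : X -> Xt) : Prop := Sheet {
  sheet_open : open V;
  sheet_base_open : open U;
  sheet_proj : forall xi, V xi -> U (p xi);
  sheet_projK : forall xi, V xi -> g (p xi) = xi;
  sheet_sec : forall x, U x -> V (g x);
  sheet_secK : forall x, U x -> p (g x) = x;
  sheet_proj_holo : forall xi, V xi -> holomorphic_at p xi;
  sheet_sec_holo : forall x, U x -> holomorphic_at g x }.

Lemma biholomorphic_sheet V U :
  open V -> open U -> biholomorphic_on V U p -> exists g, sheet V U g.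
Proof.
move=> oV oU [g [hp hg pg gp]]; exists g; split=> //.
- by move=> xi /pg[].
- by move=> xi /pg[].
- by move=> x /gp[].
- by move=> x /gp[].
- by move=> xi Vxi; exact: holomorphic_on_open oV Vxi hp.
- by move=> x Ux; exact: holomorphic_on_open oU Ux hg.
Qed.

Hypothesis cov : covering p.

Lemma exists_sheet xi : exists V U g, sheet V U g /\ V xi.
Proof.
have [U [oU [sheets [pU _ bV]]] Ux] := cov (p xi).
have : (p @^-1` U) xi by [].
rewrite pU => -[V sV Vxi]; have [oV hV] := bV V sV.
by have [g hg] := biholomorphic_sheet oV oU hV; exists V, U, g.
Qed.

Lemma proj_holomorphic : holomorphic p.
Proof.
move=> xi; have [V [U [g [sh Vxi]]]] := exists_sheet xi.
exact: sheet_proj_holo sh _ Vxi.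
Qed.

Lemma proj_continuous : continuous p.
Proof. by move=> xi; have [] := proj_holomorphic xi. Qed.

(** An evenly covered set with one point in the image lies in the image. *)
Lemma proj_surjective : nonempty_connected X -> [set: Xt] !=set0 ->
  forall x, exists xi, p xi = x.
Proof.
move=> [_ cX] [xi0 _] x.
apply: (connected_propagate (P := fun x => exists xi, p xi = x) cX _
  (x := p xi0)); last by exists xi0.
move=> {}x; have [U [oU [sheets [pU _ bV]]] Ux] := cov x.
exists U; first by apply: open_nbhs_nbhs.
move=> y z Uy Uz [xi xiy].
have : (p @^-1` U) xi by rewrite /preimage /= xiy.
rewrite pU => -[V sV Vxi]; have [oV hV] := bV V sV.
have [g sh] := biholomorphic_sheet oV oU hV.
by exists (g z); exact: sheet_secK sh _ Uz.
Qed.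

(** Both lifts stay in a sheet around the common value, where [p] is
injective. *)
Lemma near_lift_unique (T : topologicalType) (s s' : T -> Xt) x :
  {for x, continuous s} -> {for x, continuous s'} ->
  (\forall y \near x, p (s y) = p (s' y)) -> s x = s' x ->
  \forall y \near x, s y = s' y.
Proof.
move=> cs cs' ps sx; have [V [U [g [sh Vx]]]] := exists_sheet (s x).
have nV : nbhs (s x) V.
  by apply: open_nbhs_nbhs; split=> //; exact: sheet_open sh.
have nsV : \forall y \near x, V (s y) by exact: cs nV.
have nsV' : \forall y \near x, V (s' y) by apply: cs'; rewrite -sx.
apply: filterS3 ps nsV nsV' => y psy Vs Vs'.
by rewrite -(sheet_projK sh Vs) psy (sheet_projK sh Vs').
Qed.

(** Locally, [s] is the inverse of a sheet. *)
Lemma lift_holomorphic (s : X -> Xt) x :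
  {for x, continuous s} -> (\forall y \near x, p (s y) = y) ->
  holomorphic_at s x.
Proof.
move=> cs ps; have [V [U [g [sh Vx]]]] := exists_sheet (s x).
have psx := nbhs_singleton ps.
have Ux : U x by rewrite -psx; exact: sheet_proj sh _ Vx.
have hg := sheet_sec_holo sh Ux.
apply: near_holomorphic_at hg; apply: near_lift_unique => //.
- by have [] := sheet_sec_holo sh Ux.
- have nU : \forall y \near x, U y.
    by apply: open_nbhs_nbhs; split=> //; exact: sheet_base_open sh.
  by apply: filterS2 ps nU => y -> Uy; rewrite (sheet_secK sh Uy).
- by rewrite -[in LHS]psx (sheet_projK sh Vx).
Qed.

(** The coordinate of a point is the sheet that contains it. *)
Definition sheet_coordinate (U : set X) (t : Xt -> set Xt) : Prop :=
  exists sheets : set (set Xt),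
    [/\ open U, p @^-1` U = \bigcup_(V in sheets) V,
        forall V, sheets V -> exists g, sheet V U g &
        forall V xi, sheets V -> V xi -> t xi = V].

Lemma covering_local_system : local_system p sheet_coordinate.
Proof.
have coordE U t xi : sheet_coordinate U t -> U (p xi) ->
    exists g, sheet (t xi) U g /\ t xi xi.
  move=> [sheets [_ pU sh tE]] Uxi.
  have : (p @^-1` U) xi by [].
  rewrite pU => -[V sV Vxi]; rewrite (tE _ _ sV Vxi).
  by have [g hg] := sh _ sV; exists g.
have coordV U t xi zeta : sheet_coordinate U t -> U (p xi) -> t xi zeta ->
    t zeta = t xi.
  move=> [sheets [_ pU sh tE]] Uxi.
  have : (p @^-1` U) xi by [].
  by rewrite pU => -[V sV Vxi]; rewrite (tE _ _ sV Vxi) => /(tE _ _ sV).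
split.
- by move=> U t [sheets []].
- move=> x; have [U [oU [sheets [pU dj bV]]] Ux] := cov x.
  exists U, (fun xi => xget set0 [set V | sheets V /\ V xi]); split=> //.
  exists sheets; split=> //.
    by move=> V /bV[oV hV]; exact: biholomorphic_sheet.
  move=> V xi sV Vxi; case: xgetP => [W _ [sW Wxi]|/(_ V)[]//].
  by apply: (dj W V) => //; exists xi.
- move=> U t e e' Ut Ue ee' tee'.
  have [g [sh te]] := coordE _ _ _ Ut Ue.
  have [|g' [sh' te']] := coordE _ _ e' Ut; first by rewrite -ee'.
  by rewrite -(sheet_projK sh te) ee' (sheet_projK sh)// tee'.
- move=> U t e y Ut Ue Uy; have [g [sh te]] := coordE _ _ _ Ut Ue.
  exists (g y); first exact: sheet_secK sh _ Uy.
  by apply: coordV Ut Ue _; exact: sheet_sec sh _ Uy.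
- move=> U t V s e Ut Vs Ue Ve.
  have [g [sh te]] := coordE _ _ _ Ut Ue.
  have [h [sh' se]] := coordE _ _ _ Vs Ve.
  have cg : {for p e, continuous g} by have [] := sheet_sec_holo sh Ue.
  have nse : nbhs (g (p e)) (s e).
    rewrite (sheet_projK sh te).
    by apply: open_nbhs_nbhs; split=> //; exact: sheet_open sh'.
  have ng : \forall y \near p e, s e (g y) by exact: cg nse.
  have nU : \forall y \near p e, U y.
    by apply: open_nbhs_nbhs; split=> //; exact: sheet_base_open sh.
  apply: filterS2 ng nU => y sgy Uy e' e'y te'.
  apply: coordV Vs Ve _.
  have [|g' [_ te'e']] := coordE _ _ e' Ut; first by rewrite e'y.
  by rewrite te' in te'e'; rewrite -(sheet_projK sh te'e') e'y.
Qed.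

Lemma continuous_flat_at (T : topologicalType) (s : T -> Xt) x :
  {for x, continuous s} -> flat_at (q := p) (triv := sheet_coordinate) s x.
Proof.
move=> cs U t [sheets [_ pU sh tE]] Ux.
have : (p @^-1` U) (s x) by [].
rewrite pU => -[V sV Vx]; have [g hg] := sh _ sV.
have nV : \forall y \near x, V (s y).
  by apply: cs; apply: open_nbhs_nbhs; split=> //; exact: sheet_open hg.
by apply: filterS nV => y Vy; rewrite (tE _ _ sV Vx) (tE _ _ sV Vy).
Qed.

Lemma flat_at_continuous (T : topologicalType) (s : T -> Xt) x :
  {for x, continuous (p \o s)} ->
  flat_at (q := p) (triv := sheet_coordinate) s x -> {for x, continuous s}.
Proof.
move=> cps fs.
have [U [t [Ut Ux]]] := ls_cover covering_local_system (p (s x)).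
have tE := fs U t Ut Ux; have nU := near_triv covering_local_system cps Ut Ux.
have [sheets [_ pU sh tV]] := Ut.
have inV y : U (p (s y)) -> exists V g, [/\ sheet V U g, V (s y) & t (s y) = V].
  move=> Uy; have : (p @^-1` U) (s y) by [].
  rewrite pU => -[V sV Vx]; have [g hg] := sh _ sV.
  by exists V, g; split=> //; exact: tV sV Vx.
have [V [g [hg Vx txV]]] := inV x Ux.
move=> A nA.
have hA : \forall y \near x, A (g (p (s y))).
  have [cg _] := sheet_sec_holo hg Ux.
  have ngA : \forall y \near p (s x), A (g y).
    by apply: cg; rewrite (sheet_projK hg Vx).
  exact: cps ngA.
have : \forall y \near x, A (s y).
  apply: filterS3 tE nU hA => y ty Uy.
  have [W [h [hh Wy tyW]]] := inV y Uy.
  by rewrite (sheet_projK hg) //; rewrite -txV -ty tyW.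
by [].
Qed.

End Coverings.

Section DeckGroup.
Context {R : realType} {X Xt : charted_space R} {p : Xt -> X}.

Lemma deck_ext (f f' : deck p) : f =1 f' -> f = f'.
Proof.
case: f f' => [f hf of_] [f' hf' of'] /= /funext ff'.
subst f'; congr Deck; exact: Prop_irrelevance.
Qed.

Lemma deck_continuous (f : deck p) : continuous f.
Proof. by have [] := deck_homeo f. Qed.

Lemma deck_id_homeo : homeomorphism (@id Xt).
Proof. by split; [move=> x A|exists id; split=> // x A]. Qed.

Definition deck_id : deck p := Deck deck_id_homeo (fun _ => erefl).

Lemma deck_inverse (f : deck p) :
  exists f' : deck p, cancel f f' /\ cancel f' f.
Proof.
have [cf [g [cg fK gK]]] := deck_homeo f.
have hg : homeomorphism g by split=> //; exists f.
have og xi : p (g xi) = p xi by rewrite -[in RHS](gK xi) deck_over.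
by exists (Deck hg og).
Qed.

Hypothesis hp : universal_covering p.

Let hXt : complex_manifold Xt. Proof. by case: hp. Qed.
Let cov : covering p. Proof. by case: hp. Qed.
Let cp : continuous p. Proof. exact: proj_continuous. Qed.

Lemma universal_covering_connected : connected [set: Xt].
Proof. by have [_ _ [_ pT _]] := hp; exact: path_connected_connected pT. Qed.

Lemma continuous_lift_unique (s s' : Xt -> Xt) xi :
  continuous s -> continuous s' -> (forall xi, p (s xi) = p (s' xi)) ->
  s xi = s' xi -> s =1 s'.
Proof.
move=> cs cs' ps sx zeta.
apply: (flat_unique (covering_local_system cov)
  universal_covering_connected _ ps _ _ _ sx).
- by move=> x; apply: continuous_comp; [exact: cs|exact: cp].
- by move=> x; apply: continuous_flat_at; exact: cs.
- by move=> x; apply: continuous_flat_at; exact: cs'.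
Qed.

Lemma deck_free (f f' : deck p) xi : f xi = f' xi -> f = f'.
Proof.
move=> ff'; apply/deck_ext/(@continuous_lift_unique _ _ xi) => //.
- exact: deck_continuous.
- exact: deck_continuous.
- by move=> x; rewrite !deck_over.
Qed.

(** Lift [p] through itself, sending [xi] to [xi'] and conversely; by uniqueness
the two lifts are inverse to each other. *)
Lemma deck_transitive xi xi' : p xi = p xi' -> exists f : deck p, f xi = xi'.
Proof.
move=> pxi; have [_ _ sc] := hp.
have lift y y' : p y = p y' -> exists s : Xt -> Xt,
    [/\ continuous s, forall x, p (s x) = p x & s y = y'].
  move=> pyy'; have [s [ps sy fs]] := flat_lift sc
    (manifold_locally_path_connected hXt) (covering_local_system cov) cp
    (esym pyy').
  exists s; split=> // x; apply: (flat_at_continuous cov _ (fs x)).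
  by rewrite (funext ps); exact: cp.
have [s [cs ps sx]] := lift _ _ pxi.
have [r [cr pr rx]] := lift _ _ (esym pxi).
have rsK : cancel s r.
  move=> x; apply: (@continuous_lift_unique (r \o s) id xi) => //.
  - by move=> y; apply: continuous_comp; [exact: cs|exact: cr].
  - by move=> y A.
  - by move=> y; rewrite /= pr ps.
  - by rewrite /= sx.
have srK : cancel r s.
  move=> x; apply: (@continuous_lift_unique (s \o r) id xi') => //.
  - by move=> y; apply: continuous_comp; [exact: cr|exact: cs].
  - by move=> y A.
  - by move=> y; rewrite /= ps pr.
  - by rewrite /= rx.
have hs : homeomorphism s by split=> //; exists r.
by exists (Deck hs ps).
Qed.

Lemma deck_holomorphic (hX : complex_manifold X) (f : deck p) : holomorphic f.
Proof.
move=> xi; have [V [U [g [sh Vx]]]] := exists_sheet cov (f xi).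
have Uxi : U (p xi) by rewrite -(deck_over f); exact: sheet_proj sh _ Vx.
have hgp : holomorphic_at (g \o p) xi.
  apply: holomorphic_at_comp => //; first exact: proj_holomorphic.
  exact: sheet_sec_holo sh _ Uxi.
apply: near_holomorphic_at hgp; apply: (near_lift_unique cov).
- have [cg _] := sheet_sec_holo sh Uxi.
  by apply: continuous_comp; [exact: cp|].
- exact: deck_continuous.
- have nU : \forall y \near xi, U (p y).
    by apply: cp; apply: open_nbhs_nbhs; split=> //; exact: sheet_base_open sh.
  by apply: filterS nU => y Uy /=; rewrite deck_over (sheet_secK sh Uy).
- by rewrite /= -(deck_over f) (sheet_projK sh Vx).
Qed.

End DeckGroup.

(** * The quotient of a product by a twisted action of the deck group *)

Section OrbitQuotient.
Context {T : topologicalType} {I : Type} (tau : I -> T -> T).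

Lemma to_orbitE (x : T) : to_orbit tau x = orbit_pi tau x.
Proof. by rewrite /to_orbit unlock. Qed.

Lemma to_orbit_repr (e : orbit_quotient tau) : to_orbit tau (orbit_repr e) = e.
Proof. by rewrite to_orbitE; exact: orbit_reprK. Qed.

Lemma to_orbit_continuous : continuous (to_orbit tau).
Proof. exact: pi_continuous. Qed.

Lemma open_orbit_quotient (A : set (orbit_quotient tau)) :
  open A <-> open (to_orbit tau @^-1` A).
Proof. by []. Qed.

End OrbitQuotient.

Section TwistedAction.
Context {R : realType} {X Xt : charted_space R} {p : Xt -> X} {G : lie_group R}.
Variable a : deck p -> G -> G.

(** [tau_phi] is the case [a = phi], and [tau_rho] the case
[a f g = rho f * phi f g]. *)
Definition twisted_action (f : deck p) (z : prod_space Xt G) :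
  prod_space Xt G := (f z.1, a f z.2).

Definition deck_action : Prop :=
  (forall f, biholomorphic_aut G (a f)) /\
  (forall f1 f2, a (deck_comp f1 f2) = a f1 \o a f2).

Hypothesis hX : complex_manifold X.
Hypothesis cX : nonempty_connected X.
Hypothesis hp : universal_covering p.
Hypothesis hG : complex_lie_group G.
Hypothesis ha : deck_action.

Let hXt : complex_manifold Xt. Proof. by case: hp. Qed.
Let cov : covering p. Proof. by case: hp. Qed.
Let hG' : complex_manifold G. Proof. by case: hG. Qed.
Let tau := twisted_action.
Local Notation M := (prod_space Xt G).
Local Notation Q := (quotient_space tau).
Local Notation orb := (orb tau).
Local Notation pi := (@to_orbit M (deck p) tau : M -> Q).
Let hM : complex_manifold M. Proof. exact: prod_manifold. Qed.

Lemma action_id g : a deck_id g = g.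
Proof.
apply: (biholomorphic_aut_inj (ha.1 deck_id)).
have -> : a deck_id (a deck_id g) = (a deck_id \o a deck_id) g by [].
by rewrite -ha.2; congr (a _ _); exact: deck_ext.
Qed.

Lemma action_inverse (f : deck p) : exists f' : deck p,
  [/\ cancel f f', cancel f' f, cancel (a f) (a f') & cancel (a f') (a f)].
Proof.
have [f' [fK f'K]] := deck_inverse f.
exists f'; split=> // g.
  have -> : a f' (a f g) = (a f' \o a f) g by [].
  by rewrite -ha.2 -[RHS]action_id; congr (a _ _); exact: deck_ext.
have -> : a f (a f' g) = (a f \o a f') g by [].
by rewrite -ha.2 -[RHS]action_id; congr (a _ _); exact: deck_ext.
Qed.

Lemma orb_act (f : deck p) xi g : orb (f xi) (a f g) = orb xi g.
Proof.
rewrite /Defs.orb !to_orbitE.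
suff E : orbit_of tau (f xi, a f g) = orbit_of tau (xi, g).
  rewrite /orbit_pi; move: (ex_intro _ _ _) (ex_intro _ _ _).
  by rewrite E => h h'; congr exist; exact: Prop_irrelevance.
have [f' [fK f'K aK a'K]] := action_inverse f.
apply/seteqP; split=> z [h _ <-].
  exists (deck_comp h f) => //.
  by rewrite /tau /twisted_action /= ha.2.
exists (deck_comp h f') => //.
by rewrite /tau /twisted_action /= ha.2 /= fK aK.
Qed.

Lemma orb_eq xi g xi' g' :
  orb xi g = orb xi' g' -> exists f : deck p, f xi = xi' /\ a f g = g'.
Proof.
rewrite /Defs.orb !to_orbitE => /(f_equal (@sval _ _)) /= E.
have : orbit_of tau (xi', g') (xi', g').
  by exists deck_id => //; rewrite /tau /twisted_action /= action_id.
by rewrite -E => -[f _ [<- <-]]; exists f.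
Qed.

Lemma orb_inj xi g g' : orb xi g = orb xi g' -> g = g'.
Proof.
move=> /orb_eq[f [fxi <-]]; have -> : f = deck_id.
  exact: (deck_free hp (f := f) (f' := deck_id) fxi).
by rewrite action_id.
Qed.

Local Notation E := (quotient_bundle tau).
Local Notation proj := (fb_proj E).

Lemma proj_orb xi g : proj (orb xi g) = p xi.
Proof.
rewrite /=; have := to_orbit_repr (orb xi g).
case: (orbit_repr _) => xi' g' /= e.
by have [f [<- _]] := orb_eq e; rewrite deck_over.
Qed.

Lemma orb_surj (e : Q) xi : proj e = p xi -> exists g, e = orb xi g.
Proof.
rewrite /= -{2}[e]to_orbit_repr; case: (orbit_repr _) => xi' g' /= pxi.
have [f fxi] := deck_transitive hp pxi.
by exists (a f g'); rewrite -fxi orb_act.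
Qed.

Lemma exists_orb (e : Q) : exists xi g, e = orb xi g.
Proof.
exists (orbit_repr e).1, (orbit_repr e).2.
by rewrite /Defs.orb -surjective_pairing to_orbit_repr.
Qed.

Lemma pi_continuous_at z : {for z, continuous pi}.
Proof. exact: to_orbit_continuous. Qed.

Lemma action_holomorphic (f : deck p) : holomorphic (tau f).
Proof.
move=> z.
apply: (@holomorphic_at_pair R M Xt G (fun z => f z.1) (fun z => a f z.2) z).
  apply: (@holomorphic_at_comp R M Xt Xt fst f z hXt).
    exact: holomorphic_at_fst.
  exact: deck_holomorphic.
apply: (@holomorphic_at_comp R M G G snd (a f) z hG').
  exact: holomorphic_at_snd.
by have /biholomorphic_autP[b [h _ _ _]] := ha.1 f; exact: h.
Qed.

(** The saturation of an open set is the union of its translates. *)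
Lemma pi_open (A : set M) : open A -> open (pi @` A).
Proof.
move=> oA; apply/open_orbit_quotient.
rewrite (_ : _ @^-1` _ = \bigcup_(f in [set: deck p]) tau f @^-1` A).
  apply: bigcup_open => f _; apply: open_comp => // z _.
  by have [] := action_holomorphic f z.
apply/seteqP; split=> [[xi g] [[xi' g'] Az /esym/orb_eq[f [e1 e2]]]|].
  by exists f => //=; rewrite /tau /twisted_action /= e1 e2.
move=> [xi g] [f _ /= Af]; exists (tau f (xi, g)) => //.
exact: orb_act.
Qed.

Lemma near_pi (A : set Q) z : (\forall y \near z, A (pi y)) -> nbhs (pi z) A.
Proof.
move=> nA.
have oi : open (pi @` (pi @^-1` A)°) by apply: pi_open; exact: open_interior.
apply: (@filterS _ _ _ (pi @` (pi @^-1` A)°)).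
  by move=> _ [y /interior_subset Ay <-].
by apply: open_nbhs_nbhs; split=> //; exists z.
Qed.

Lemma proj_pi_continuous : continuous proj.
Proof.
move=> e; have [xi [g ->]] := exists_orb e; rewrite /continuous_at proj_orb.
move=> A nA; apply: near_pi.
have h : \forall z \near ((xi, g) : M), A (p z.1).
  have np : \forall zeta \near xi, A (p zeta).
    exact: proj_continuous cov xi _ nA.
  exact: cvg_fst np.
by apply: filterS h => -[zeta h] /=; rewrite -(proj_orb zeta h).
Qed.

Lemma quotient_transition c d :
  cs_atlas Q c -> cs_atlas Q d -> holomorphic_transition c d.
Proof.
move=> [_ hc] [_ hd] e ce de.
have [xi [g ez]] := exists_orb e; rewrite ez in ce de *.
have [c' [Mc' c'x cE]] := hc (xi, g) ce.
have [d' [Md' d'x dE]] := hd (xi, g) de.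
have [h [hh hE]] := maximal_atlas_transition hM Mc' Md' c'x d'x.
exists h; split; first by rewrite [c _](nbhs_singleton cE).
apply: near_pi; apply: filterS3 cE dE hE => y cy dy hy.
by rewrite [LHS]dy hy -cy.
Qed.

(** The covering map is injective on a sheet, so two points of an orbit over one
sheet have the same first component; the deck group acts freely. *)
Lemma orb_sheet_inj V U s xi g xi' g' : sheet (p := p) V U s -> V xi -> V xi' ->
  orb xi g = orb xi' g' -> (xi, g) = (xi', g').
Proof.
move=> sh Vxi Vxi' e.
have pE : p xi = p xi' by rewrite -(proj_orb xi g) e proj_orb.
have xiE : xi = xi' by rewrite -(sheet_projK sh Vxi) pE (sheet_projK sh Vxi').
by subst xi'; rewrite (orb_inj e).
Qed.

(** A chart of [Xt * G] inside the product of a sheet with [G] descends, because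
the projection is injective there. At the other points of the orbits through its
domain, it lifts to the translates of the chart. *)
Lemma exists_quotient_chart (z : M) :
  exists2 c, cs_atlas Q c & chart_dom c (pi z).
Proof.
case: z => xi g.
have [c1 Mc1 c1x] := exists_chart xi hXt.
have [c2 Gc2 c2g] := exists_chart g hG'.
have [V [U [s [sh Vxi]]]] := exists_sheet cov xi.
pose c0 : chart M (cs_dim M) := prod_chart c1 c2.
have Mc0 : cs_atlas M c0 by exists c1, c2.
have [oc0 ic0 cc0 pc0] : is_chart c0 by case: hM => _ + _ _; exact.
pose O : set M := chart_dom c0 `&` (V `*` setT).
have oO : open O.
  by apply: openI => //; apply: open_setX; [exact: sheet_open sh|exact: openT].
have injO w w' : O w -> O w' -> pi w = pi w' -> w = w'.
  case: w w' => [x h] [x' h'] [_ [/= Vx _]] [_ [/= Vx' _]].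
  exact: (orb_sheet_inj sh).
pose rep (e : Q) : M := xget (xi, g) [set w | O w /\ pi w = e].
have repE w : O w -> rep (pi w) = w.
  move=> Ow; rewrite /rep; case: xgetP => [w' _ [Ow' e]|/(_ w)[]//].
  exact: injO.
pose c : chart Q (cs_dim Q) := Chart (pi @` O) (c0 \o rep).
have nO w : O w -> nbhs w O by move=> Ow; exact: open_nbhs_nbhs.
have Oz : O (xi, g) by split.
exists c; last by exists (xi, g).
split.
  split.
  - exact: pi_open.
  - move=> _ _ /set_mem[w Ow <-] /set_mem[w' Ow' <-] /=.
    rewrite !repE // => e; congr pi; apply: ic0 e; rewrite inE;
    by [case: Ow|case: Ow'].
  - move=> _ [w Ow <-] A /=; rewrite repE // => nA; apply: near_pi.
    have nA' : \forall y \near w, A (c0 y) by exact: cc0 (proj1 Ow) _ nA.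
    by apply: filterS2 nA' (nO w Ow) => y Ay Oy; rewrite /= repE.
  - move=> W oW WO; rewrite (_ : _ @` W = c0 @` (O `&` pi @^-1` W)).
      apply: pc0; last by move=> y [[]].
      by apply: openI => //;
        exact: open_comp (fun x _ => @pi_continuous_at x) oW.
    apply/seteqP; split=> [_ [e We <-]|_ [w [Ow Ww] <-]].
      have [w Ow ew] := WO _ We; exists w.
        by split=> //=; rewrite /preimage /= ew.
      by rewrite /= -ew repE.
    by exists (pi w) => //=; rewrite repE.
move=> [x h] [[x' h'] Ow /orb_eq[f [fx fh]]].
have [f' [fK f'K aK a'K]] := action_inverse f.
have tK : cancel (tau f) (tau f').
  by case=> y k; rewrite /tau /twisted_action /= fK aK.
have t'K : cancel (tau f') (tau f).
  by case=> y k; rewrite /tau /twisted_action /= f'K a'K.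
have twx : tau f' (x, h) = (x', h').
  by rewrite -[RHS]tK /tau /twisted_action /= fx fh.
exists (transport_chart c0 (tau f')); split.
- apply: transport_maximal_atlas tK t'K _ => //.
  + exact: action_holomorphic.
  + exact: action_holomorphic.
  + exact: sub_maximal_atlas.
- by have [+ _] := Ow; rewrite -twx.
have nOt : \forall y \near ((x, h) : M), O (tau f' y).
  have [ct _] := action_holomorphic f' (x, h).
  have nOw : nbhs (tau f' (x, h)) O by rewrite twx; exact: nO.
  exact: ct nOw.
apply: filterS nOt => -[y k] Oy /=.
have -> : to_orbit tau (y, k) = pi (tau f' (y, k)) by exact/esym/orb_act.
by rewrite /= repE.
Qed.

(** Points over distinct points of [X] are separated there; points of one fibre
are separated by their [G]-coordinates over a sheet. *)
Lemma quotient_hausdorff : hausdorff_space Q.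
Proof.
move=> e e' cl.
have projE : proj e = proj e'.
  have [hX0 _ _ _] := hX; apply: hX0 => A B nA nB.
  have [x [Ax Bx]] := cl _ _ (proj_pi_continuous nA) (proj_pi_continuous nB).
  by exists (proj x).
have [xi [g eE]] := exists_orb e; rewrite eE in cl projE *.
rewrite proj_orb in projE; have [g' eE'] := orb_surj (esym projE).
rewrite eE' in cl *; congr (Defs.orb _ _ _).
have [hG0 _ _ _] := hG'; apply: hG0 => A B nA nB.
have [V [U [s [sh Vxi]]]] := exists_sheet cov xi.
have nbox h (D : set G) : nbhs h D -> nbhs (orb xi h) (pi @` (V `*` D)).
  move=> nD; apply: near_pi; apply: (@filterS _ _ _ (V `*` D)).
    by move=> y Vy; exists y.
  exists (V, D) => //; split=> //.
  by apply: open_nbhs_nbhs; split=> //; exact: sheet_open sh.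
have [_ [[[x h] [/= Vx Ah] <-] [[x' h'] [/= Vx' Bh'] ee']]] :=
  cl _ _ (nbox _ _ nA) (nbox _ _ nB).
exists h; split=> //.
by have [_ <-] : (x', h') = (x, h) by exact: (orb_sheet_inj sh).
Qed.

Lemma quotient_manifold : complex_manifold Q.
Proof.
split.
- exact: quotient_hausdorff.
- by move=> c [].
- by move=> e; have [xi [g ->]] := exists_orb e; exact: exists_quotient_chart.
- exact: quotient_transition.
Qed.

(** The projection to the quotient is a local biholomorphism, by the very choice
of the charts: it is holomorphic, and maps out of the quotient are holomorphic
when their composites with it are. *)
Lemma pi_holomorphic : holomorphic pi.
Proof.
move=> z; split; first exact: pi_continuous_at.
move=> c d Mc [_ hd] cz dz; have [d' [Md' d'z dE]] := hd _ dz.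
have tr := maximal_atlas_transition hM (sub_maximal_atlas hM Mc) Md' cz d'z.
by apply: near_holomorphic_in tr; apply: filterS dE => y.
Qed.

Lemma holomorphic_at_descent (N : charted_space R) (F : Q -> N) z :
  complex_manifold N -> holomorphic_at (F \o pi) z -> holomorphic_at F (pi z).
Proof.
move=> hN hF; split.
  move=> A nA; apply: near_pi.
  by have [cF _] := hF; exact: cF nA.
move=> c d [_ hc] Nd cz dz; have [c' [Mc' c'z cE]] := hc _ cz.
have [g [hg gE]] :=
  holomorphic_at_in hM hN hF Mc' (sub_maximal_atlas hN Nd) c'z dz.
exists g; split; first by rewrite [c _](nbhs_singleton cE).
by apply: near_pi; apply: filterS2 cE gE => y -> <-.
Qed.

Lemma quotient_proj_holomorphic : holomorphic (M := Q) (N := X) proj.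
Proof.
move=> e; have [xi [g ->]] := exists_orb e.
apply: holomorphic_at_descent => //.
rewrite (_ : _ \o _ = p \o fst); last first.
  by apply/funext => -[zeta h]; exact: proj_orb.
apply: (@holomorphic_at_comp R M Xt X fst p) => //.
  exact: holomorphic_at_fst.
exact: proj_holomorphic.
Qed.

(** The flat trivialisation attached to a local section [s] of the covering. The
coordinate [t] is determined by [s] over [U] only, so it is kept as a separate
variable. *)
Definition adapted (U : set X) (t : Q -> G) (s : X -> Xt) : Prop :=
  open U /\ forall x, U x ->
    [/\ {for x, continuous s}, p (s x) = x & forall h, t (orb (s x) h) = h].

Lemma adapted_flat U t s : adapted U t s -> fb_flat E (U, t).
Proof. by move=> [oU h]; split=> //; exists s. Qed.

Lemma flat_adapted U t : fb_flat E (U, t) -> exists s, adapted U t s.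
Proof. by move=> [/= oU [s h]]; exists s. Qed.

Section Adapted.
Context {U : set X} {t : Q -> G} {s : X -> Xt}.
Hypothesis ad : adapted U t s.

Lemma adapted_nbhs x : U x -> \forall y \near x, U y.
Proof. by move=> Ux; apply: open_nbhs_nbhs; split=> //; exact: ad.1. Qed.

Lemma adapted_continuous x : U x -> {for x, continuous s}.
Proof. by move=> /ad.2[]. Qed.

Lemma adapted_secK x : U x -> p (s x) = x.
Proof. by move=> /ad.2[]. Qed.

Lemma adapted_orbK x h : U x -> t (orb (s x) h) = h.
Proof. by move=> /ad.2[]. Qed.

Lemma adapted_orb e : U (proj e) -> orb (s (proj e)) (t e) = e.
Proof.
move=> Ue; have [g eE] := orb_surj (esym (adapted_secK Ue)).
by rewrite [in LHS]eE adapted_orbK -?eE.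
Qed.

Lemma adapted_holomorphic x : U x -> holomorphic_at s x.
Proof.
move=> Ux; apply: (lift_holomorphic cov); first exact: adapted_continuous.
by apply: filterS (adapted_nbhs Ux) => y; exact: adapted_secK.
Qed.

Lemma adapted_section_near x : U x ->
  \forall zeta \near s x, U (p zeta) /\ s (p zeta) = zeta.
Proof.
move=> Ux; have cp : {for s x, continuous p} by exact: proj_continuous.
have nU : \forall zeta \near s x, U (p zeta).
  by apply: cp; rewrite adapted_secK //; exact: adapted_nbhs.
have nE : \forall zeta \near s x, s (p zeta) = zeta.
  apply: (near_lift_unique cov (s := s \o p) (s' := id)).
  - apply: continuous_comp; first exact: cp.
    by rewrite adapted_secK //; exact: adapted_continuous.
  - by move=> A.
  - by apply: filterS nU => z Uz /=; rewrite adapted_secK.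
  - by rewrite /= adapted_secK.
exact: filterI nU nE.
Qed.

Lemma adapted_near x h : U x ->
  \forall z \near ((s x, h) : M), t (pi z) = z.2.
Proof.
move=> Ux.
have h1 : \forall z \near ((s x, h) : M), U (p z.1) /\ s (p z.1) = z.1.
  exact: cvg_fst (adapted_section_near Ux).
apply: filterS h1 => -[zeta k] /= [Uz <-].
exact: adapted_orbK.
Qed.

Lemma adapted_triv_holomorphic e : U (proj e) ->
  holomorphic_at (M := Q) (N := G) t e.
Proof.
move=> Ue; rewrite -(adapted_orb Ue).
apply: holomorphic_at_descent => //.
have hs := @holomorphic_at_snd R Xt G (s (proj e), t e) hG'.
apply: near_holomorphic_at hs.
by apply: filterS (adapted_near (t e) Ue) => z /= ->.
Qed.

Lemma adapted_inverse_holomorphic (z : prod_space X G) : U z.1 ->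
  holomorphic_at (M := prod_space X G) (N := Q) (fun z => orb (s z.1) z.2) z.
Proof.
move=> Uz.
apply: (@holomorphic_at_comp R (prod_space X G) M Q
  (fun z => (s z.1, z.2)) pi z hM); last exact: pi_holomorphic.
apply: (@holomorphic_at_pair R (prod_space X G) Xt G (fun z => s z.1) snd).
  apply: (@holomorphic_at_comp R (prod_space X G) X Xt fst s z hX).
    exact: holomorphic_at_fst.
  exact: adapted_holomorphic.
exact: holomorphic_at_snd.
Qed.

Lemma adapted_local_trivialization : local_trivialization (E := E) U t.
Proof.
split; first exact: ad.1.
exists (fun z => orb (s z.1) z.2); split.
- apply: holomorphic_at_on => e Ue.
  apply: (@holomorphic_at_pair R Q X G).
    exact: quotient_proj_holomorphic.
  exact: adapted_triv_holomorphic.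
- by apply: holomorphic_at_on => z [Uz _]; exact: adapted_inverse_holomorphic.
- move=> e Ue; split=> //=; exact: adapted_orb Ue.
- move=> [x h] [/= Ux _].
  have projE : proj (orb (s x) h) = x by rewrite proj_orb adapted_secK.
  split; last first.
    suff : (proj (orb (s x) h), t (orb (s x) h)) = (x, h) by [].
    by rewrite projE adapted_orbK.
  have : U (proj (orb (s x) h)) by rewrite projE.
  by [].
Qed.

End Adapted.

Lemma exists_coordinate U (s : X -> Xt) :
  open U -> (forall x, U x -> {for x, continuous s} /\ p (s x) = x) ->
  exists t, adapted U t s.
Proof.
move=> oU sU; pose coord (e : Q) : set G := fun h => e = orb (s (proj e)) h.
exists (fun e => xget 1%g (coord e)); split=> // x Ux; have [cs ps] := sU x Ux.
split=> // h.
have cE h' : coord (orb (s x) h) h' = (orb (s x) h = orb (s x) h').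
  by rewrite /coord proj_orb ps.
by case: xgetP => [h' _|/(_ h)]; rewrite cE // => /orb_inj.
Qed.

Lemma exists_adapted xi :
  exists U t s, [/\ adapted U t s, U (p xi) & s (p xi) = xi].
Proof.
have [V [U [s [sh Vxi]]]] := exists_sheet cov xi.
have [|x Ux|t ad] := @exists_coordinate U s.
- exact: sheet_base_open sh.
- by split; [have [] := sheet_sec_holo sh Ux|exact: sheet_secK sh _ Ux].
- exists U, t, s; split=> //; first exact: sheet_proj sh _ Vxi.
  exact: sheet_projK sh _ Vxi.
Qed.

Lemma exists_adapted_at x :
  exists U t s, adapted U t s /\ U x.
Proof.
have [|xi <-] := proj_surjective cov cX _ x.
  by have [_ _ []] := hp.
by have [U [t [s [ad Ux _]]]] := exists_adapted xi; exists U, t, s.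
Qed.

(** Two sections of the covering differ locally by a deck transformation [f],
and [[s y, g] = [f (s y), a f g]]. *)
Lemma adapted_transition U t s V u r x :
  adapted U t s -> adapted V u r -> U x -> V x ->
  exists f : deck p, \forall y \near x, forall e, proj e = y -> u e = a f (t e).
Proof.
move=> adU adV Ux Vx.
have [|f fE] := deck_transitive hp (xi := s x) (xi' := r x).
  by rewrite (adapted_secK adU Ux) (adapted_secK adV Vx).
exists f.
have cf : {for x, continuous (f \o s)}.
  apply: continuous_comp; first exact: adapted_continuous adU _ Ux.
  exact: deck_continuous.
have nUV : \forall y \near x, U y /\ V y.
  by apply: filterS2 (adapted_nbhs adU Ux) (adapted_nbhs adV Vx).
have fsr : \forall y \near x, f (s y) = r y.
  apply: (near_lift_unique cov (s := f \o s)) => //.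
    exact: adapted_continuous adV _ Vx.
  apply: filterS nUV => y [Uy Vy] /=.
  by rewrite deck_over (adapted_secK adU) // (adapted_secK adV).
apply: filterS2 fsr nUV => y fy [Uy Vy] e ey; rewrite -ey in Uy fy Vy.
rewrite -[in LHS](adapted_orb adU Uy) -(orb_act f) fy.
exact: adapted_orbK adV _ _ Vy.
Qed.

Lemma quotient_flat_structure (A : set (G -> G)) :
  (forall f, A (a f)) -> flat_structure (F := G) A E.
Proof.
move=> hA; split.
- by move=> U t /flat_adapted[s ad]; exact: adapted_local_trivialization ad.
- move=> x; have [U [t [s [ad Ux]]]] := exists_adapted_at x.
  by exists U, t; split=> //; exact: adapted_flat ad.
- move=> U t V u /flat_adapted[s adU] /flat_adapted[r adV] x [Ux Vx].
  by have [f hf] := adapted_transition adU adV Ux Vx; exists (a f).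
Qed.

End TwistedAction.

(** * Flat bundle maps *)

Section FlatMaps.
Context {R : realType} {X F : charted_space R}.
Hypothesis hF : complex_manifold F.
Local Notation Aut := (biholomorphic_aut F).

Lemma flat_structure_sub (A B : set (F -> F)) (E : flat_bundle X F) :
  A `<=` B -> flat_structure A E -> flat_structure B E.
Proof.
move=> AB [h1 h2 h3]; split=> // U t V s Ut Vs x UVx.
by have [a Aa aE] := h3 U t V s Ut Vs x UVx; exists a => //; exact: AB.
Qed.

(** Flatness may be tested in one pair of flat trivialisations around each
point, since transition functions are locally constant. *)
Lemma local_flat_map (E E' : flat_bundle X F) (U : set X) (psi : E -> E') :
  flat_structure Aut E -> flat_structure Aut E' -> open U ->
  (forall e, U (fb_proj E e) -> fb_proj E' (psi e) = fb_proj E e) ->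
  (forall x, U x -> exists V t V' t',
    [/\ fb_flat E (V, t), fb_flat E' (V', t'), V x, V' x &
        locally_constant_in Aut [set x] t t' psi]) ->
  flat_map U psi.
Proof.
move=> [_ _ fE] [_ _ fE'] oU psiE loc W u W' u' Wu Wu' x [Ux [Wx W'x]].
have [V [t [V' [t' [Vt Vt' Vx V'x lc]]]]] := loc x Ux.
have [a Aa aE] := lc x erefl.
have [b Ab bE] := fE _ _ _ _ Wu Vt x (conj Wx Vx).
have [c Ac cE] := fE' _ _ _ _ Vt' Wu' x (conj V'x W'x).
exists (c \o (a \o b)).
  by apply: biholomorphic_aut_comp => //; exact: biholomorphic_aut_comp.
have nU : \forall y \near x, U y by exact: open_nbhs_nbhs.
have abE : \forall y \near x, forall e, fb_proj E e = y ->
    t' (psi e) = a (b (u e)).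
  by apply: filterS2 aE bE => y ha hb e ey; rewrite ha // hb.
by apply: filterS3 abE cE nU => y hab hc Uy e ey; rewrite hc ?hab // psiE ey.
Qed.

End FlatMaps.

(** * The flat group bundle and its torsors *)

Section FlatTorsors.
Context {R : realType} {X Xt : charted_space R} {p : Xt -> X} {G : lie_group R}.
Variable phi : deck p -> G -> G.

Hypothesis hX : complex_manifold X.
Hypothesis cX : nonempty_connected X.
Hypothesis hp : universal_covering p.
Hypothesis hG : complex_lie_group G.
Hypothesis hphi : aut_morphism phi.

Let hG' : complex_manifold G. Proof. by case: hG. Qed.
Local Notation GG := (G_phi phi).
Local Notation prG := (fb_proj GG).
Local Notation orbG := (orb (tau_phi phi)).
Local Notation mulG := (@gb_mul R X G GG).

Lemma phiM f : {morph phi f : g h / (g * h)%g}.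
Proof. by have [/(_ f)[]] := hphi. Qed.

Lemma phi1 f : phi f 1%g = 1%g.
Proof. by apply: (mulgI (phi f 1%g)); rewrite -phiM !mulg1. Qed.

Lemma phi_action : deck_action phi.
Proof. by have [h1 h2] := hphi; split=> // f; have [] := h1 f. Qed.

Lemma holomorphic_at_mul (M : charted_space R) (f g : M -> G) x :
  holomorphic_at (N := G) f x -> holomorphic_at (N := G) g x ->
  holomorphic_at (N := G) (fun y => (f y * g y)%g) x.
Proof.
move=> hf hg; have [_ hm _] := hG.
apply: (@holomorphic_at_comp R M (prod_space G G) G (fun y => (f y, g y))
  (fun z => (z.1 * z.2)%g)); first exact: prod_manifold.
  exact: holomorphic_at_pair.
exact: hm.
Qed.

Lemma mulg_biholomorphic (k : G) : biholomorphic_aut G (fun g => (k * g)%g).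
Proof.
apply/biholomorphic_autP; exists (fun g => (k^-1 * g)%g); split.
- move=> g; apply: holomorphic_at_mul; first exact: holomorphic_at_cst.
  exact: holomorphic_at_id.
- move=> g; apply: holomorphic_at_mul; first exact: holomorphic_at_cst.
  exact: holomorphic_at_id.
- by move=> g; rewrite mulKg.
- by move=> g; rewrite mulVKg.
Qed.

Definition crossed_action (rho : deck p -> G) (f : deck p) (g : G) : G :=
  (rho f * phi f g)%g.

(** The crossed morphism identity says precisely that this is an action. *)
Lemma crossed_action_deck rho : Z1 phi rho -> deck_action (crossed_action rho).
Proof.
move=> hrho; split=> [f|f1 f2].
  have := @biholomorphic_aut_comp R G (fun g => (rho f * g)%g) (phi f) hG'
    (mulg_biholomorphic (rho f)).
  by apply; exact: phi_action.1.
apply/funext => g; rewrite /crossed_action /= hrho phi_action.2 /= phiM.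
by rewrite mulgA.
Qed.

Lemma orbG_act (f : deck p) xi g : orbG (f xi) (phi f g) = orbG xi g.
Proof. exact: (orb_act phi_action). Qed.

Lemma orbG_eq xi g xi' g' :
  orbG xi g = orbG xi' g' -> exists f : deck p, f xi = xi' /\ phi f g = g'.
Proof. exact: (orb_eq phi_action). Qed.

Lemma orbG_inj xi g g' : orbG xi g = orbG xi g' -> g = g'.
Proof. exact: (orb_inj hp phi_action). Qed.

Lemma prG_orb xi g : prG (orbG xi g) = p xi.
Proof. exact: (proj_orb phi_action). Qed.

Lemma orbG_surj (e : GG) xi : prG e = p xi -> exists g, e = orbG xi g.
Proof. exact: (orb_surj hp phi_action). Qed.

Lemma exists_orbG (e : GG) : exists xi g, e = orbG xi g.
Proof. exact: exists_orb. Qed.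

(** Two points of [Xt] over the base point differ by a single deck
transformation [f], which acts on [G] by the group automorphism [phi f]. *)
Lemma gb_mul_orb xi g h :
  mulG (orbG xi g) (orbG xi h) = orbG xi (g * h)%g.
Proof.
rewrite /=; case: xgetP => [w _ [xi' [g' [h' [/orbG_eq[f [fx <-]] e2 ->]]]]|].
  have [f' [f'x <-]] := orbG_eq e2.
  have -> : f' = f by apply: (deck_free hp (xi := xi)); rewrite fx.
  by rewrite -phiM -fx orbG_act.
by move=> /(_ (orbG xi (g * h)%g))[]; exists xi, g, h.
Qed.

Lemma fibre_unit_orb xi g : @fibre_unit R X G GG (orbG xi g) <-> g = 1%g.
Proof.
split=> [/(_ (orbG xi 1%g))|-> u].
  rewrite prG_orb gb_mul_orb mulg1 prG_orb => /(_ erefl)[h _].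
  exact: (orbG_inj h).
rewrite prG_orb => /orbG_surj[h ->].
by rewrite !gb_mul_orb mul1g mulg1.
Qed.

Lemma G_phi_fibrewise_group : fibrewise_group GG.
Proof.
split.
- move=> u v; have [xi [g ->]] := exists_orbG u; rewrite prG_orb => /esym.
  by move=> /orbG_surj[h ->]; rewrite gb_mul_orb !prG_orb.
- move=> u v w; have [xi [g ->]] := exists_orbG u; rewrite prG_orb => uv vw.
  rewrite -uv in vw; have [h vE] := @orbG_surj v xi (esym uv); subst v.
  by have [k ->] := orbG_surj (esym vw); rewrite !gb_mul_orb mulgA.
- move=> x; have [xi <-] : exists xi, p xi = x.
    by have [_ cov [nXt _ _]] := hp; exact: proj_surjective.
  by exists (orbG xi 1%g); [exact: prG_orb|exact/fibre_unit_orb].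
- move=> u; have [xi [g ->]] := exists_orbG u.
  exists (orbG xi g^-1%g); rewrite !prG_orb !gb_mul_orb; split=> //.
    by apply/fibre_unit_orb; rewrite mulgV.
  by apply/fibre_unit_orb; rewrite mulVg.
Qed.

Lemma adapted_fibrewise_morphism U t s :
  adapted (a := phi) U t s -> fibrewise_morphism (GG := GG) U t.
Proof.
move=> ad u v Uu uv.
have [x [Ux xu]] : exists x, U x /\ prG u = x by exists (prG u).
have [g ->] : exists g, u = orbG (s x) g.
  by apply: orbG_surj; rewrite xu (adapted_secK ad).
have [h ->] : exists h, v = orbG (s x) h.
  by apply: orbG_surj; rewrite -uv xu (adapted_secK ad).
by rewrite gb_mul_orb; rewrite ![t _](adapted_orbK ad).
Qed.

Lemma G_phi_flat_group_bundle : is_flat_group_bundle GG.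
Proof.
split; last first.
- by move=> U t /flat_adapted[s ad]; exact: adapted_fibrewise_morphism ad.
- apply: (quotient_flat_structure hX cX hp hG phi_action) => f.
  by have [/(_ f)] := hphi.
split.
- exact: (quotient_manifold hX hp hG phi_action).
- exact: (quotient_proj_holomorphic hX hp hG phi_action).
- exact: G_phi_fibrewise_group.
- move=> x; have [U [t [s [ad Ux]]]] := exists_adapted_at cX hp phi_action x.
  exists U, t; split=> //; last exact: adapted_fibrewise_morphism ad.
  exact: (adapted_local_trivialization hX hp hG phi_action ad).
Qed.

Lemma G_phi_flat_structure :
  flat_structure (F := G) (biholomorphic_aut G) GG.
Proof.
have [_ fs _] := G_phi_flat_group_bundle.
by apply: flat_structure_sub fs => f [].
Qed.

Section Torsor.
Variable rho : deck p -> G.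
Hypothesis hrho : Z1 phi rho.
Local Notation PP := (P_rho phi rho).
Local Notation prP := (fb_proj PP).
Local Notation orbP := (orb (tau_rho phi rho)).
Local Notation actP := (@ts_act R X G GG PP).
Local Notation b := (crossed_action rho).
Let hb : deck_action b. Proof. exact: crossed_action_deck. Qed.

Lemma orbP_act (f : deck p) xi h : orbP (f xi) (rho f * phi f h)%g = orbP xi h.
Proof. exact: (orb_act hb). Qed.

Lemma orbP_eq xi h xi' h' : orbP xi h = orbP xi' h' ->
  exists f : deck p, f xi = xi' /\ (rho f * phi f h)%g = h'.
Proof. exact: (orb_eq hb). Qed.

Lemma prP_orb xi h : prP (orbP xi h) = p xi.
Proof. exact: (proj_orb hb). Qed.

Lemma orbP_surj (u : PP) xi : prP u = p xi -> exists h, u = orbP xi h.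
Proof. exact: (orb_surj hp hb). Qed.

Lemma exists_orbP (u : PP) : exists xi h, u = orbP xi h.
Proof. exact: (exists_orb (a := b)). Qed.

Lemma ts_act_orb xi h g : actP (orbP xi h) (orbG xi g) = orbP xi (h * g)%g.
Proof.
rewrite /=; case: xgetP => [w _ [xi' [h' [g' [/orbP_eq[f [fx <-]] e2 ->]]]]|].
  have [f' [f'x <-]] := orbG_eq e2.
  have -> : f' = f by apply: (deck_free hp (xi := xi)); rewrite fx.
  by rewrite -mulgA -phiM -fx orbP_act.
by move=> /(_ (orbP xi (h * g)%g))[]; exists xi, h, g.
Qed.

Lemma P_rho_fibrewise_action : fibrewise_action PP.
Proof.
split.
- move=> u v; have [xi [h ->]] := exists_orbP u; rewrite prP_orb => uv.
  by have [g ->] := orbG_surj (esym uv); rewrite ts_act_orb prP_orb.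
- move=> u e; have [xi [h ->]] := exists_orbP u; rewrite prP_orb => ue.
  have [g ->] := orbG_surj (esym ue) => /fibre_unit_orb->.
  by rewrite ts_act_orb mulg1.
- move=> u v w; have [xi [h ->]] := exists_orbP u; rewrite prP_orb => uv vw.
  rewrite -uv in vw; have [g vE] := @orbG_surj v xi (esym uv).
  have [k wE] := @orbG_surj w xi (esym vw).
  by rewrite vE wE gb_mul_orb !ts_act_orb mulgA.
Qed.

Section Trivialization.
Variables (U : set X) (s : X -> Xt) (t : PP -> G) (v : GG -> G).
Hypothesis adP : adapted (a := b) U t s.
Hypothesis adG : adapted (a := phi) U v s.

Let secK x : U x -> p (s x) = x. Proof. exact: adapted_secK adP x. Qed.

(** In the coordinates given by one section [s] of the covering, the action is
the multiplication of [G]. The right-hand side makes sense off the fibre product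
and serves as the local holomorphic extension of the action. *)
Lemma act_adapted (u : PP) (w : GG) : U (prP u) -> prP u = prG w ->
  actP u w = orbP (s (prP u)) (t u * v w)%g.
Proof.
move=> Uu uw; have [x [Ux xu]] : exists x, U x /\ prP u = x by exists (prP u).
have [h uE] : exists h, u = orbP (s x) h by apply: orbP_surj; rewrite xu secK.
have [g wE] : exists g, w = orbG (s x) g.
  by apply: orbG_surj; rewrite -uw xu secK.
rewrite xu uE wE ts_act_orb.
by rewrite [t _](adapted_orbK adP) // [v _](adapted_orbK adG).
Qed.

Let hPP : complex_manifold PP.
Proof. exact: (quotient_manifold hX hp hG hb). Qed.
Let hGG : complex_manifold GG.
Proof. exact: (quotient_manifold hX hp hG phi_action). Qed.

Lemma P_rho_act_holomorphic (z : prod_space PP GG) :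
  U (prP z.1) -> U (prG z.2) ->
  holomorphic_at (M := prod_space PP GG) (N := PP)
    (fun z => orbP (s (prP z.1)) (t z.1 * v z.2)%g) z.
Proof.
move=> Uz1 Uz2.
apply: (@holomorphic_at_comp R (prod_space PP GG) (prod_space X G) PP
  (fun z => (prP z.1, (t z.1 * v z.2)%g)) (fun y => orbP (s y.1) y.2) z).
- exact: prod_manifold.
- apply: (@holomorphic_at_pair R (prod_space PP GG) X G (fun z => prP z.1)).
    apply: (@holomorphic_at_comp R (prod_space PP GG) PP X fst prP z hPP).
      exact: holomorphic_at_fst.
    exact: (quotient_proj_holomorphic hX hp hG hb).
  apply: (@holomorphic_at_mul (prod_space PP GG) (fun z => t z.1)
    (fun z => v z.2)).
    apply: (@holomorphic_at_comp R (prod_space PP GG) PP G fst t z hPP).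
      exact: holomorphic_at_fst.
    exact: (adapted_triv_holomorphic hX hp hG hb adP).
  apply: (@holomorphic_at_comp R (prod_space PP GG) GG G snd v z hGG).
    exact: holomorphic_at_snd.
  exact: (adapted_triv_holomorphic hX hp hG phi_action adG).
- exact: (adapted_inverse_holomorphic hX hp hG adP).
Qed.

(** The local isomorphism [[s y, g] |-> [s y, g]] of the group bundle with the
torsor; it is the identity in the coordinates given by [s]. *)
Definition orb_translation (e : GG) : PP := orbP (s (prG e)) (v e).

Lemma orb_translation_orb x g : U x ->
  orb_translation (orbG (s x) g) = orbP (s x) g.
Proof.
by move=> Ux; rewrite /orb_translation prG_orb secK // [v _](adapted_orbK adG).
Qed.

Lemma orb_translation_bundle_iso :
  bundle_iso (E := GG) (E' := PP) U orb_translation.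
Proof.
have prE e : U (prG e) -> prP (orb_translation e) = prG e.
  by move=> Ue; rewrite prP_orb secK.
split; last exact: prE.
exists (fun u => orbG (s (prP u)) (t u)); split.
- apply: holomorphic_at_on => e Ue.
  apply: (@holomorphic_at_comp R GG (prod_space X G) PP
    (fun e => (prG e, v e)) (fun y => orbP (s y.1) y.2) e).
  + exact: prod_manifold.
  + apply: (@holomorphic_at_pair R GG X G).
      exact: (quotient_proj_holomorphic hX hp hG phi_action).
    exact: (adapted_triv_holomorphic hX hp hG phi_action adG).
  + exact: (adapted_inverse_holomorphic hX hp hG adP).
- apply: holomorphic_at_on => e Ue.
  apply: (@holomorphic_at_comp R PP (prod_space X G) GG
    (fun e => (prP e, t e)) (fun y => orbG (s y.1) y.2) e).
  + exact: prod_manifold.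
  + apply: (@holomorphic_at_pair R PP X G).
      exact: (quotient_proj_holomorphic hX hp hG hb).
    exact: (adapted_triv_holomorphic hX hp hG hb adP).
  + exact: (adapted_inverse_holomorphic hX hp hG adG).
- move=> e Ue; split.
    by have : U (prP (orb_translation e)) by rewrite prE.
  rewrite prE // /orb_translation [t _](adapted_orbK adP) //.
  exact: (adapted_orb hp phi_action adG).
- move=> u Uu; have prE' : prG (orbG (s (prP u)) (t u)) = prP u.
    by rewrite prG_orb secK.
  split; first by have : U (prG (orbG (s (prP u)) (t u))) by rewrite prE'.
  rewrite /orb_translation prE' [v _](adapted_orbK adG) //.
  exact: (adapted_orb hp hb adP).
Qed.

Lemma orb_translation_trivialization : torsor_trivialization U orb_translation.
Proof.
split; [exact: adP.1|exact: orb_translation_bundle_iso|].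
move=> e w Ue ew.
have [x [Ux xe]] : exists x, U x /\ prG e = x by exists (prG e).
have [g ->] : exists g, e = orbG (s x) g by apply: orbG_surj; rewrite xe secK.
have [h ->] : exists h, w = orbG (s x) h.
  by apply: orbG_surj; rewrite -ew xe secK.
by rewrite gb_mul_orb !orb_translation_orb // ts_act_orb.
Qed.

Lemma orb_translation_flat : flat_map (E := GG) (E' := PP) U orb_translation.
Proof.
apply: (local_flat_map hG').
- exact: G_phi_flat_structure.
- by apply: (quotient_flat_structure hX cX hp hG hb); exact: hb.1.
- exact: adP.1.
- by move=> e Ue; rewrite prP_orb secK.
move=> x Ux; exists U, v, U, t; split=> //.
- exact: adapted_flat adG.
- exact: adapted_flat adP.
move=> _ ->; exists id; first exact: biholomorphic_aut_id.
apply: filterS (adapted_nbhs adP Ux) => y Uy e ey; rewrite -ey in Uy.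
exact: (adapted_orbK adP).
Qed.

End Trivialization.

Lemma exists_adapted_pair x : exists U s t v,
  [/\ U x, adapted (a := b) U t s & adapted (a := phi) U v s].
Proof.
have [U [t [s [ad Ux]]]] := exists_adapted_at cX hp hb x.
have [|y Uy|v adv] := @exists_coordinate _ _ _ _ _ _ hp phi_action U s.
- exact: ad.1.
- by have [] := ad.2 _ Uy.
by exists U, s, t, v.
Qed.

Lemma P_rho_flat_torsor : is_flat_torsor PP.
Proof.
split; last first.
- move=> x; have [U [s [t [v [Ux adP adG]]]]] := exists_adapted_pair x.
  exists U, (orb_translation s v); split=> //.
    exact: orb_translation_trivialization adP adG.
  exact: orb_translation_flat adP adG.
- by apply: (quotient_flat_structure hX cX hp hG hb); exact: hb.1.
- split.
  + exact: (quotient_manifold hX hp hG hb).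
  + exact: (quotient_proj_holomorphic hX hp hG hb).
  + move=> [u w] /= uw; have [U [s [t [v [Uu adP adG]]]]] :=
      exists_adapted_pair (prP u).
    exists (fun z => orbP (s (prP z.1)) (t z.1 * v z.2)%g); split.
      by apply: (P_rho_act_holomorphic adP adG) => //=; rewrite -uw.
    have nU : \forall y \near ((u, w) : PP * GG), U (prP y.1).
      have np : \forall u' \near u, U (prP u').
        have [cpr _] := quotient_proj_holomorphic hX hp hG hb u.
        exact: cpr (adapted_nbhs adP Uu).
      exact: cvg_fst np.
    apply: filterS nU => -[u' w'] /= Uu' uw'.
    exact/esym/(act_adapted adP adG).
  + exact: P_rho_fibrewise_action.
  + move=> x; have [U [s [t [v [Ux adP adG]]]]] := exists_adapted_pair x.
    exists U, (orb_translation s v); split=> //.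
    exact: orb_translation_trivialization adP adG.
- exact: G_phi_flat_group_bundle.
Qed.

End Torsor.

(** * Flat sections along the universal covering *)

Section FlatSections.
Variable Q : flat_torsor_data GG.
Hypothesis hQ : is_flat_torsor Q.
Local Notation prQ := (fb_proj Q).
Local Notation act := (@ts_act R X G GG Q).
Local Notation trivQ := (fun U t => fb_flat Q (U, t)).

Let hQ0 : complex_manifold Q. Proof. by case: hQ => _ []. Qed.

Lemma pr_act u xi g : prQ u = p xi -> prQ (act u (orbG xi g)) = p xi.
Proof.
have [_ [_ _ _ [h _ _] _] _ _] := hQ => ux.
by rewrite h // ux prG_orb.
Qed.

Lemma act_act u xi g h : prQ u = p xi ->
  act (act u (orbG xi g)) (orbG xi h) = act u (orbG xi (g * h)%g).
Proof.
have [_ [_ _ _ [_ _ hM] _] _ _] := hQ => ux.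
by rewrite hM ?prG_orb // gb_mul_orb.
Qed.

Lemma torsor_act U psi xi g h : torsor_trivialization (P := Q) U psi ->
  U (p xi) -> act (psi (orbG xi g)) (orbG xi h) = psi (orbG xi (g * h)%g).
Proof.
move=> [_ _ eq] Uxi; rewrite -eq ?prG_orb // ?gb_mul_orb //.
by have : U (prG (orbG xi g)) by rewrite prG_orb.
Qed.

Lemma torsor_pr U psi xi g : torsor_trivialization (P := Q) U psi ->
  U (p xi) -> prQ (psi (orbG xi g)) = p xi.
Proof.
move=> [_ [_ eq] _] Uxi; rewrite eq ?prG_orb //.
by have : U (prG (orbG xi g)) by rewrite prG_orb.
Qed.

Lemma torsor_surj U psi xi u : torsor_trivialization (P := Q) U psi ->
  U (p xi) -> prQ u = p xi -> exists g, u = psi (orbG xi g).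
Proof.
move=> [_ [[th [_ _ _ thK]] eq] _] Uxi ux.
have Uu : fb_over (E := Q) U u by have : U (prQ u) by rewrite ux.
have [Uth psith] := thK u Uu.
have prE : prG (th u) = p xi by rewrite -eq // psith.
by have [g thE] := orbG_surj prE; exists g; rewrite -thE psith.
Qed.

Lemma torsor_inj U psi xi g h : torsor_trivialization (P := Q) U psi ->
  U (p xi) -> psi (orbG xi g) = psi (orbG xi h) -> g = h.
Proof.
move=> [_ [[th [_ _ psiK _]] eq] _] Uxi e.
have Uo k : fb_over (E := GG) U (orbG xi k).
  by have : U (prG (orbG xi k)) by rewrite prG_orb.
have := (psiK _ (Uo g)).2; rewrite e (psiK _ (Uo h)).2.
by move=> /orbG_inj.
Qed.

Lemma exists_torsor_trivialization x : exists U psi,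
  torsor_trivialization (P := Q) U psi /\ U x.
Proof.
have [_ [_ _ _ _ h] _ _] := hQ.
by have [U [psi [Ux hpsi]]] := h x; exists U, psi.
Qed.

Lemma act_free u xi g h : prQ u = p xi ->
  act u (orbG xi g) = act u (orbG xi h) -> g = h.
Proof.
move=> ux; have [U [psi [hpsi Uxi]]] := exists_torsor_trivialization (p xi).
have [k ->] := torsor_surj hpsi Uxi ux.
by rewrite !(torsor_act _ _ hpsi) // => /(torsor_inj hpsi Uxi)/mulgI.
Qed.

Lemma act_transitive u u' xi : prQ u = p xi -> prQ u' = p xi ->
  exists g, u' = act u (orbG xi g).
Proof.
move=> ux ux'; have [U [psi [hpsi Uxi]]] := exists_torsor_trivialization (p xi).
have [k ->] := torsor_surj hpsi Uxi ux.
have [k' ->] := torsor_surj hpsi Uxi ux'.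
by exists (k^-1 * k')%g; rewrite (torsor_act _ _ hpsi) // mulVKg.
Qed.

Definition flat_section (s : Xt -> Q) : Prop :=
  (forall xi, prQ (s xi) = p xi) /\
  (forall xi, flat_at (q := prQ) (triv := trivQ) s xi).

Lemma flat_bundle_local_system : local_system prQ trivQ.
Proof.
have [_ _ [h1 h2 h3] _] := hQ; split.
- by move=> U t /h1[].
- exact: h2.
- move=> U t e e' /h1[_ [th [_ _ K _]]] Ue ee' tee'.
  have Ue' : U (prQ e') by rewrite -ee'.
  by rewrite -(K e Ue).2 -(K e' Ue').2 /= ee' tee'.
- move=> U t e y /h1[_ [th [_ _ _ K]]] Ue Uy.
  have [_ E] := K (y, t e) (conj Uy I).
  by exists (th (y, t e)); [exact: (f_equal fst E)|exact: (f_equal snd E)].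
- move=> U t V s e Ut Vs Ue Ve.
  have [a _ aE] := h3 _ _ _ _ Ut Vs _ (conj Ue Ve).
  have eE := nbhs_singleton aE e erefl.
  apply: filterS aE => y aE e' e'y te'.
  by rewrite [s e'](aE e' e'y) te' -eE.
Qed.

Lemma exists_flat_section : exists s, flat_section s.
Proof.
have [hXt cov sc] := hp; have [[xi0 _] _ _] := sc.
have [U [psi [hpsi Uxi]]] := exists_torsor_trivialization (p xi0).
have [s [ps _ fs]] := flat_lift (e0 := psi (orbG xi0 1%g)) sc
  (manifold_locally_path_connected hXt) flat_bundle_local_system
  (proj_continuous cov) (torsor_pr _ hpsi Uxi).
by exists s; split=> // xi; exact: ps.
Qed.

(** An equivariant trivialisation [psi] of [Q] near [p xi0], together with its
expression in a flat trivialisation [t'] of [Q]. Along the covering, [[xi, g]]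
has the flat coordinate [g], so flatness of [psi] means that [a] does not depend
on [xi]. *)
Definition flat_frame (xi0 : Xt) (U : set X) (psi : GG -> Q) (V' : set X)
    (t' : Q -> G) (a : G -> G) : Prop :=
  [/\ torsor_trivialization (P := Q) U psi, U (p xi0), fb_flat Q (V', t'),
      biholomorphic_aut G a &
      V' (p xi0) /\ \forall xi \near xi0, U (p xi) /\
        forall g, t' (psi (orbG xi g)) = a g].

Lemma exists_flat_frame xi0 :
  exists U psi V' t' a, flat_frame xi0 U psi V' t' a.
Proof.
have [_ _ [_ h2 _] h] := hQ; have [_ cov _] := hp.
have [U [psi [Ux hpsi fpsi]]] := h (p xi0).
have [V' [t' [Vt' V'x]]] := h2 (p xi0).
have [W [v [r [ad Wx rx]]]] := exists_adapted hp phi_action xi0.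
have [a Aa aE] := fpsi _ _ _ _ (adapted_flat ad) Vt' _ (conj Ux (conj Wx V'x)).
exists U, psi, V', t', a; split=> //; split=> //.
have cp : {for xi0, continuous p} by exact: proj_continuous.
have n1 : \forall xi \near xi0, forall e, prG e = p xi -> t' (psi e) = a (v e).
  exact: cp _ aE.
have n2 := adapted_section_near hp ad Wx; rewrite rx in n2.
have n3 : \forall xi \near xi0, U (p xi).
  by apply: cp; apply: open_nbhs_nbhs; split=> //; have [] := hpsi.
apply: filterS3 n1 n2 n3 => xi /= aE' [Wxi rxi] Uxi; split=> // g.
rewrite (aE' (orbG xi g)); last exact: prG_orb.
by congr a; rewrite -rxi; exact: (adapted_orbK ad).
Qed.

(** In a frame, [s] reads [xi |-> psi [xi, k xi]]; its flat coordinate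
[a (k xi)] is locally constant and [a] is injective. *)
Lemma flat_section_frame s xi0 U psi V' t' a :
  flat_section s -> flat_frame xi0 U psi V' t' a ->
  exists k, \forall xi \near xi0, s xi = psi (orbG xi k).
Proof.
move=> [ps fs] [hpsi Ux Vt' Aa [V'x nE]].
have [k kE] := torsor_surj hpsi Ux (ps xi0).
exists k; have V'sx : V' (prQ (s xi0)) by rewrite ps.
have [_ aE0] := nbhs_singleton nE.
apply: filterS2 nE (fs xi0 _ _ Vt' V'sx) => xi [Uxi aE] tE.
have [g gE] := torsor_surj hpsi Uxi (ps xi).
rewrite gE; congr (psi (orbG xi _)).
apply: (biholomorphic_aut_inj Aa).
by rewrite -aE -gE tE kE aE0.
Qed.

Lemma frame_flat_section s : (forall xi, prQ (s xi) = p xi) ->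
  (forall xi0 U psi V' t' a, flat_frame xi0 U psi V' t' a ->
     exists k, \forall xi \near xi0, s xi = psi (orbG xi k)) ->
  flat_section s.
Proof.
move=> ps hs; split=> // xi0.
have [U [psi [V' [t' [a fr]]]]] := exists_flat_frame xi0.
have [k kE] := hs _ _ _ _ _ _ fr; have [hpsi Ux Vt' Aa [V'x nE]] := fr.
have [_ cov _] := hp.
apply: (in_flat_at flat_bundle_local_system _ Vt').
- by rewrite (_ : _ \o _ = p); [exact: proj_continuous|exact/funext].
- by rewrite ps.
have [_ aE0] := nbhs_singleton nE.
have kE0 := nbhs_singleton kE.
by apply: filterS2 nE kE => xi [_ aE] ->; rewrite aE kE0 aE0.
Qed.

Lemma flat_section_act s k :
  flat_section s -> flat_section (fun xi => act (s xi) (orbG xi k)).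
Proof.
move=> fs; have [ps _] := fs; apply: frame_flat_section.
  by move=> xi; exact: pr_act.
move=> xi0 U psi V' t' a fr; have [k0 kE] := flat_section_frame fs fr.
have [hpsi _ _ _ [_ nE]] := fr; exists (k0 * k)%g.
by apply: filterS2 nE kE => xi [Uxi _] ->; rewrite (torsor_act _ _ hpsi).
Qed.

(** In a frame, the element of [G] by which the sections differ is locally
constant, and the covering space is connected. *)
Lemma flat_section_unique s s' : flat_section s -> flat_section s' ->
  exists k, forall xi, s' xi = act (s xi) (orbG xi k).
Proof.
move=> fs fs'; have [ps _] := fs; have [ps' _] := fs'.
have [_ _ [[xi0 _] _ _]] := hp.
have [k kE] := act_transitive (ps xi0) (ps' xi0); exists k => xi.
apply: (connected_propagate (P := fun xi => s' xi = act (s xi) (orbG xi k))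
  (universal_covering_connected hp) _ xi kE) => {kE}xi1.
have [U [psi [V' [t' [a fr]]]]] := exists_flat_frame xi1.
have [k1 k1E] := flat_section_frame fs fr.
have [k1' k1'E] := flat_section_frame fs' fr.
have [hpsi _ _ _ [_ nE]] := fr.
exists [set xi | [/\ s xi = psi (orbG xi k1), s' xi = psi (orbG xi k1') &
                   U (p xi)]].
  by apply: filterS3 k1E k1'E nE => y ? ? [].
move=> y z [sy s'y Uy] [sz s'z Uz].
rewrite sy s'y (torsor_act _ _ hpsi Uy) => /(torsor_inj hpsi Uy) k1kE.
by rewrite sz s'z (torsor_act _ _ hpsi Uz) k1kE.
Qed.

(** The crossed morphism [rho] measures how the flat section [s] fails to be
invariant under deck transformations. *)
Definition monodromy (s : Xt -> Q) (rho : deck p -> G) : Prop :=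
  flat_section s /\
  forall (f : deck p) xi, s xi = act (s (f xi)) (orbG (f xi) (rho f)).

(** Compare [s xi] with [s (f1 (f2 xi))] directly and through [s (f2 xi)]. *)
Lemma monodromy_Z1 s rho : monodromy s rho -> Z1 phi rho.
Proof.
move=> [[ps _] sE] f1 f2; have [_ _ [[xi _] _ _]] := hp.
have psf (f : deck p) : prQ (s (f xi)) = p xi by rewrite ps deck_over.
apply: (act_free (u := s (f1 (f2 xi))) (xi := f1 (f2 xi))); first exact: ps.
have := sE (deck_comp f1 f2) xi => /= <-.
rewrite -act_act ?ps // -sE orbG_act; exact: sE.
Qed.

(** The pullback of a flat section by a deck transformation is flat. *)
Lemma exists_monodromy s : flat_section s -> exists rho, monodromy s rho.
Proof.
move=> fs; have [ps fs'] := fs.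
have /choice[rho rhoE] : forall f : deck p, exists k, forall xi,
    s xi = act (s (f xi)) (orbG (f xi) k).
  move=> f; have ff : flat_section (s \o f).
    split=> xi; first by rewrite /= ps deck_over.
    by apply: flat_at_comp; [exact: deck_continuous|exact: fs'].
  have [k kE] := flat_section_unique ff fs.
  by exists (phi f k) => xi; rewrite orbG_act.
by exists rho.
Qed.

Lemma monodromy_gauge s rho g :
  monodromy s rho -> exists s', monodromy s' (gauge phi g rho).
Proof.
move=> [fs sE]; have [ps _] := fs.
exists (fun xi => act (s xi) (orbG xi g^-1%g)); split.
  exact: flat_section_act.
move=> f xi; rewrite act_act ?ps // /gauge !mulgA mulVg mul1g.
by rewrite -act_act ?ps // -sE orbG_act.
Qed.

Lemma monodromy_unique s rho s' rho' : monodromy s rho -> monodromy s' rho' ->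
  exists g, rho' = gauge phi g rho.
Proof.
move=> [fs sE] [fs' s'E]; have [ps _] := fs.
have [k kE] := flat_section_unique fs fs'.
exists k^-1%g; apply/funext => f; have [_ _ [[xi _] _ _]] := hp.
rewrite /gauge invgK; apply: (mulgI k); rewrite !mulgA mulgV mul1g.
apply: (act_free (ps (f xi))).
rewrite -act_act ?ps // -kE -s'E -act_act ?ps //.
by rewrite -sE orbG_act.
Qed.

(** * Torsors with a given monodromy *)

Section Classification.
Variable rho : deck p -> G.
Hypothesis hrho : Z1 phi rho.
Local Notation PP := (P_rho phi rho).
Local Notation prP := (fb_proj PP).
Local Notation orbP := (orb (tau_rho phi rho)).
Local Notation actP := (@ts_act R X G GG PP).
Local Notation b := (crossed_action rho).
Let hb : deck_action b. Proof. exact: crossed_action_deck. Qed.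
Let hPP : complex_manifold PP.
Proof. exact: (quotient_manifold hX hp hG hb). Qed.

(** The image of the flat section [xi |-> [xi, 1]] of [P_rho]. *)
Lemma iso_monodromy : flat_torsor_iso PP Q -> exists s, monodromy s rho.
Proof.
move=> [Psi [[_ prE] eq fl]]; have [_ cov _] := hp.
have psE xi g : prQ (Psi (orbP xi g)) = p xi.
  by rewrite prE // prP_orb.
exists (fun xi => Psi (orbP xi 1%g)); split; last first.
  move=> f xi; rewrite -eq ?ts_act_orb ?prP_orb ?prG_orb // mul1g.
  by rewrite -(orbP_act hrho f) phi1 mulg1.
split=> // xi0.
have [_ _ [_ h2 _] _] := hQ; have [V' [t' [Vt' V'x]]] := h2 (p xi0).
have [U [t [r [ad Ux rx]]]] := exists_adapted hp hb xi0.
have [a _ aE] :=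
  fl _ _ _ _ (adapted_flat ad) Vt' (p xi0) (conj I (conj Ux V'x)).
have cp : {for xi0, continuous p} by exact: proj_continuous.
apply: (in_flat_at flat_bundle_local_system _ Vt').
- rewrite (_ : _ \o _ = p); first exact: cp.
  by apply/funext => xi; exact: psE.
- by rewrite psE.
have n1 : \forall xi \near xi0, forall e, prP e = p xi -> t' (Psi e) = a (t e).
  exact: cp _ aE.
have n2 := adapted_section_near hp ad Ux; rewrite rx in n2.
have tE : \forall xi \near xi0, t' (Psi (orbP xi 1%g)) = a 1%g.
  apply: filterS2 n1 n2 => xi aE' [Uxi rxi].
  rewrite aE' ?prP_orb //; congr a; rewrite -rxi.
  exact: (adapted_orbK ad).
by have tE0 := nbhs_singleton tE; apply: filterS tE => xi ->.
Qed.

Section OfMonodromy.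
Variable s : Xt -> Q.
Hypothesis hs : monodromy s rho.

Let ps xi : prQ (s xi) = p xi. Proof. by case: hs => -[]. Qed.

(** The map [[xi, h] |-> s xi * [xi, h]]. That it does not depend on the
representative is the relation between [s] and [rho]. *)
Definition torsor_map (u : PP) : Q :=
  act (s (orbit_repr u).1) (orbG (orbit_repr u).1 (orbit_repr u).2).

Lemma torsor_map_orb xi h : torsor_map (orbP xi h) = act (s xi) (orbG xi h).
Proof.
rewrite /torsor_map; have := to_orbit_repr (orbP xi h).
case: (orbit_repr _) => xi' h' /= e.
have [f [fx <-]] := orbP_eq hrho (esym e).
have [_ sE] := hs.
by rewrite -act_act ?ps // -fx -sE orbG_act.
Qed.

Lemma pr_torsor_map u : prQ (torsor_map u) = prP u.
Proof.
have [xi [h ->]] := exists_orbP u.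
by rewrite torsor_map_orb pr_act ?ps // prP_orb.
Qed.

Lemma torsor_map_bij : exists th : Q -> PP,
  cancel torsor_map th /\ cancel th torsor_map.
Proof.
have [_ cov [nXt _ _]] := hp.
have /choice[th thE] : forall e, exists u, torsor_map u = e.
  move=> e; have [xi xiE] := proj_surjective cov cX nXt (prQ e).
  have [g ->] := act_transitive (ps xi) (esym xiE).
  by exists (orbP xi g); exact: torsor_map_orb.
exists th; split=> // u; have := thE (torsor_map u).
have [xi [h ->]] := exists_orbP u.
have : prP (th (torsor_map (orbP xi h))) = p xi.
  by rewrite -pr_torsor_map thE torsor_map_orb pr_act.
move=> /(orbP_surj hrho)[k ->]; rewrite !torsor_map_orb.
by move=> /(act_free (ps xi))->.
Qed.

Lemma torsor_map_equivariant u w : prP u = prG w ->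
  torsor_map (actP u w) = act (torsor_map u) w.
Proof.
have [xi [h ->]] := exists_orbP u; rewrite (prP_orb hrho) => /esym.
move=> /orbG_surj[g ->].
by rewrite (ts_act_orb hrho) !torsor_map_orb act_act.
Qed.

(** In a frame with [s xi = psi [xi, k]], the map is
[[xi, h] |-> psi [xi, k * h]]. *)
Lemma torsor_map_holomorphic : holomorphic (M := PP) (N := Q) torsor_map.
Proof.
move=> u; have [xi0 [h0 ->]] := exists_orbP u.
apply: (holomorphic_at_descent hX hp hG hb) => //.
have [U [psi [V' [t' [a fr]]]]] := exists_flat_frame xi0.
have [fs _] := hs; have [k kE] := flat_section_frame fs fr.
have [hpsi Ux _ _ [_ nE]] := fr; have [oU [[th [hpsi_on _ _ _]] _] _] := hpsi.
have hloc : holomorphic_at (M := prod_space Xt G) (N := Q)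
    (fun z => psi (orbG z.1 (k * z.2)%g)) (xi0, h0).
  have [hXt _ _] := hp.
  apply: (@holomorphic_at_comp R (prod_space Xt G) GG Q
    (fun z => orbG z.1 (k * z.2)%g) psi).
  - exact: (quotient_manifold hX hp hG phi_action).
  - apply: (@holomorphic_at_comp R (prod_space Xt G) (prod_space Xt G) GG
      (fun z => (z.1, (k * z.2)%g)) (fun z => orbG z.1 z.2)).
    + exact: prod_manifold.
    + apply: (@holomorphic_at_pair R (prod_space Xt G) Xt G fst).
        exact: holomorphic_at_fst.
      apply: (@holomorphic_at_mul (prod_space Xt G) (fun=> k) snd).
        exact: holomorphic_at_cst.
      exact: holomorphic_at_snd.
    + have hpi := pi_holomorphic phi hp hG (xi0, (k * h0)%g).
      apply: (@near_holomorphic_at R (prod_space Xt G) GG _ _ _ _ hpi).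
      by apply: filterE => -[].
  - apply: holomorphic_on_open hpsi_on.
      apply: open_comp oU => e _.
      have [ce _] := quotient_proj_holomorphic hX hp hG phi_action e.
      exact: ce.
    by have : U (prG (orbG xi0 (k * h0)%g)) by rewrite prG_orb.
apply: near_holomorphic_at hloc.
have n1 : \forall z \near ((xi0, h0) : prod_space Xt G),
    U (p z.1) /\ s z.1 = psi (orbG z.1 k).
  have n : \forall xi \near xi0, U (p xi) /\ s xi = psi (orbG xi k).
    by apply: filterS2 nE kE => xi [].
  exact: cvg_fst n.
apply: filterS n1 => -[xi h] /= [Uxi sE].
by rewrite [RHS]torsor_map_orb sE (torsor_act _ _ hpsi).
Qed.

(** In the same frame, with a section [r] of the covering and the coordinate [v]
of the group bundle given by it, the inverse sends [psi e] to
[[r y, k^-1 * v e]], where [y] is the base point. *)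
Lemma torsor_map_inverse_holomorphic (th : Q -> PP) :
  cancel torsor_map th -> cancel th torsor_map ->
  holomorphic (M := Q) (N := PP) th.
Proof.
move=> mapK thK e0.
have [_ cov [nXt _ _]] := hp.
have [xi0 xi0E] := proj_surjective cov cX nXt (prQ e0).
have [U [psi [V' [t' [a fr]]]]] := exists_flat_frame xi0.
have [fs _] := hs; have [k kE] := flat_section_frame fs fr.
have [hpsi Ux _ _ [_ nE]] := fr.
have [oU [[ph [_ hph _ phK]] prpsi] _] := hpsi.
have [W [v [r [adG Wx rx]]]] := exists_adapted hp phi_action xi0.
have [|y Wy|t adP] := @exists_coordinate _ _ _ _ _ _ hp hb W r.
- exact: adG.1.
- by have [] := adG.2 _ Wy.
have hprQ : holomorphic prQ by case: hQ => _ [].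
have hph0 : holomorphic_at (M := Q) (N := GG) ph e0.
  apply: holomorphic_on_open hph.
    by apply: open_comp oU => e _; have [ce _] := hprQ e; exact: ce.
  by have : U (prQ e0) by rewrite -xi0E.
have prph e : U (prQ e) -> prG (ph e) = prQ e.
  by move=> Ue; have [Uph phE] := phK e Ue; rewrite -prpsi // phE.
have Wph : W (prG (ph e0)) by rewrite prph -xi0E.
have hloc : holomorphic_at (M := Q) (N := PP)
    (fun e => orbP (r (prQ e)) (k^-1 * v (ph e))%g) e0.
  apply: (@holomorphic_at_comp R Q (prod_space X G) PP
    (fun e => (prQ e, (k^-1 * v (ph e))%g)) (fun z => orbP (r z.1) z.2)).
  - exact: prod_manifold.
  - apply: (@holomorphic_at_pair R Q X G); first exact: hprQ.
    apply: (@holomorphic_at_mul Q (fun=> k^-1%g) (v \o ph)).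
      exact: holomorphic_at_cst.
    apply: (@holomorphic_at_comp R Q GG G ph v).
    + exact: (quotient_manifold hX hp hG phi_action).
    + exact: hph0.
    + exact: (adapted_triv_holomorphic hX hp hG phi_action adG).
  - by apply: (adapted_inverse_holomorphic hX hp hG adP); rewrite /= -xi0E.
apply: near_holomorphic_at hloc.
have nr : \forall y \near prQ e0, [/\ W y, U y & s (r y) = psi (orbG (r y) k)].
  have cr : {for p xi0, continuous r} by exact: (adapted_continuous adG).
  rewrite -rx in kE; have nk := cr _ kE; rewrite -xi0E.
  have nU : \forall y \near p xi0, U y by exact: open_nbhs_nbhs.
  by apply: filterS3 (adapted_nbhs adG Wx) nU nk => y.
have [cpr _] := hprQ e0.
have n1 : \forall e \near e0, [/\ W (prQ e), U (prQ e) &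
    s (r (prQ e)) = psi (orbG (r (prQ e)) k)] by exact: cpr nr.
apply: filterS n1 => e [We Ue sE].
have prr : p (r (prQ e)) = prQ e by exact: (adapted_secK adG).
suff mE : torsor_map (orbP (r (prQ e)) (k^-1 * v (ph e))%g) = e.
  by rewrite -[in RHS]mE mapK.
rewrite torsor_map_orb sE (torsor_act _ _ hpsi) ?prr // mulVKg.
rewrite -[in RHS](phK e Ue).2; congr psi.
rewrite -(prph e Ue); apply: (adapted_orb hp phi_action adG).
by have : W (prG (ph e)) by rewrite prph.
Qed.

Lemma torsor_map_flat : flat_map (E := PP) (E' := Q) setT torsor_map.
Proof.
have [_ _ fQ _] := hQ; have [_ _ fP _] := P_rho_flat_torsor hrho.
apply: (local_flat_map hG' fP fQ openT).
  by move=> u _; exact: pr_torsor_map.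
move=> x _; have [_ cov [nXt _ _]] := hp.
have [xi0 xi0E] := proj_surjective cov cX nXt x; subst x.
have [U [psi [V' [t' [a fr]]]]] := exists_flat_frame xi0.
have [fs _] := hs; have [k kE] := flat_section_frame fs fr.
have [hpsi Ux Vt' Aa [V'x nE]] := fr.
have [W [t [r [ad Wx rx]]]] := exists_adapted hp hb xi0.
exists W, t, V', t'; split=> //; first exact: adapted_flat ad.
move=> _ ->; exists (a \o (fun g => (k * g)%g)).
  by apply: biholomorphic_aut_comp => //; exact: mulg_biholomorphic.
have cr : {for p xi0, continuous r} by exact: (adapted_continuous ad).
rewrite -rx in kE nE; have nk := cr _ kE; have n2 := cr _ nE.
apply: filterS3 (adapted_nbhs ad Wx) nk n2 => y Wy sE [Ury aE] u uy.
rewrite -uy in Wy sE Ury aE.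
have prr : p (r (prP u)) = prP u by exact: (adapted_secK ad).
rewrite -[in LHS](adapted_orb hp hb ad Wy) torsor_map_orb sE.
by rewrite (torsor_act _ _ hpsi Ury) aE.
Qed.

Lemma monodromy_iso : flat_torsor_iso PP Q.
Proof.
have [th [mapK thK]] := torsor_map_bij.
exists torsor_map; split.
- split; last by move=> u _; exact: pr_torsor_map.
  exists th; split=> //.
  + by apply/holomorphic_on_setT; exact: torsor_map_holomorphic.
  + by apply/holomorphic_on_setT; exact: torsor_map_inverse_holomorphic.
- exact: torsor_map_equivariant.
- exact: torsor_map_flat.
Qed.

End OfMonodromy.
End Classification.
End FlatSections.

(** * The classification *)

Section IsoEquivalence.
Implicit Types P Q S : flat_torsor_data GG.

Lemma flat_torsor_iso_refl P : is_flat_torsor P -> flat_torsor_iso P P.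
Proof.
move=> [_ [hP _ _ _ _] [_ _ fP] _]; exists id; split=> //.
- split=> //; exists id; split=> //; apply/holomorphic_on_setT => x;
  exact: holomorphic_at_id.
- by move=> V t V' t' Vt Vt' x [_ Vx]; exact: fP Vt Vt' x Vx.
Qed.

Lemma flat_torsor_iso_sym P Q : flat_torsor_iso P Q -> flat_torsor_iso Q P.
Proof.
move=> [psi [[[th [hpsi hth psiK thK]] prpsi] eq fl]].
have prth e : fb_proj P (th e) = fb_proj Q e.
  by rewrite -prpsi // (thK e I).2.
exists th; split.
- by split=> [|e _]; [exists psi|exact: prth].
- move=> u v uv; have uv' : fb_proj P (th u) = prG v by rewrite prth.
  by rewrite -[in LHS](thK u I).2 -eq // (psiK _ I).2.
- move=> V t V' t' Vt Vt' x [_ [Vx V'x]].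
  have [a Aa aE] := fl _ _ _ _ Vt' Vt x (conj I (conj V'x Vx)).
  have [b [Ab aK bK]] := biholomorphic_aut_inv Aa; exists b => //.
  apply: filterS aE => y aE e ey.
  by rewrite -[in RHS](thK e I).2 aE ?aK // prth.
Qed.

Lemma flat_torsor_iso_trans P Q S :
  is_flat_torsor Q -> flat_torsor_iso P Q -> flat_torsor_iso Q S ->
  flat_torsor_iso P S.
Proof.
move=> [_ [hQ _ _ _ _] [_ coverQ _] _].
move=> [psi [[[th [hpsi hth psiK thK]] prpsi] eq fl]].
move=> [psi' [[[th' [hpsi' hth' psiK' thK']] prpsi'] eq' fl']].
exists (psi' \o psi); split.
- split; last by move=> e _; rewrite /= prpsi' // prpsi.
  exists (th \o th'); split.
  + apply/holomorphic_on_setT => x; apply: holomorphic_at_comp => //.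
      exact: (holomorphic_on_setT psi).1.
    exact: (holomorphic_on_setT psi').1.
  + apply/holomorphic_on_setT => x; apply: holomorphic_at_comp => //.
      exact: (holomorphic_on_setT th').1.
    exact: (holomorphic_on_setT th).1.
  + by move=> x _; split=> //=; rewrite (psiK' _ I).2 (psiK _ I).2.
  + by move=> x _; split=> //=; rewrite (thK _ I).2 (thK' _ I).2.
- by move=> u v uv; rewrite /= eq // eq' // prpsi.
- move=> V t V' t' Vt Vt' x [_ [Vx V'x]].
  have [W [u [Wu Wx]]] := coverQ x.
  have [a Aa aE] := fl _ _ _ _ Vt Wu x (conj I (conj Vx Wx)).
  have [b Ab bE] := fl' _ _ _ _ Wu Vt' x (conj I (conj Wx V'x)).
  exists (b \o a); first exact: biholomorphic_aut_comp.
  apply: filterS2 aE bE => y aE bE e ey /=.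
  by rewrite bE ?aE // prpsi.
Qed.

Lemma iso_class_eq P Q : is_flat_torsor P -> is_flat_torsor Q ->
  flat_torsor_iso P Q -> iso_class P = iso_class Q.
Proof.
move=> hP hQ PQ; apply/funext => S; apply/propext; split=> -[hS iS]; split=> //.
  exact: flat_torsor_iso_trans hP (flat_torsor_iso_sym PQ) iS.
exact: flat_torsor_iso_trans hQ PQ iS.
Qed.

End IsoEquivalence.

Lemma gauge_gauge g h rho :
  gauge phi g (gauge phi h rho) = gauge phi (g * h)%g rho.
Proof. by apply/funext => f; rewrite /gauge invgM phiM !mulgA. Qed.

Lemma gauge_id rho : gauge phi 1%g rho = rho.
Proof. by apply/funext => f; rewrite /gauge invg1 phi1 mul1g mulg1. Qed.

Lemma cohomology_class_refl rho : cohomology_class phi rho rho.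
Proof. by exists 1%g => //; exact: gauge_id. Qed.

Lemma cohomology_class_gauge g rho :
  cohomology_class phi (gauge phi g rho) = cohomology_class phi rho.
Proof.
apply/seteqP; split=> _ [h _ <-].
  by exists (h * g)%g => //; rewrite gauge_gauge.
by exists (h * g^-1)%g => //; rewrite gauge_gauge -mulgA mulVg mulg1.
Qed.

(** Both conditions say that one of the torsors has flat sections with crossed
morphisms [rho] and [rho']. *)
Lemma cohomologous_iso rho rho' : Z1 phi rho -> Z1 phi rho' ->
  cohomology_class phi rho = cohomology_class phi rho' <->
  flat_torsor_iso (P_rho phi rho) (P_rho phi rho').
Proof.
move=> hrho hrho'; have hP := P_rho_flat_torsor hrho.
have hP' := P_rho_flat_torsor hrho'.
split=> [cl|iso].
  have := cohomology_class_refl rho'; rewrite -cl => -[g _ gE].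
  have [s hs] := iso_monodromy hP hrho (flat_torsor_iso_refl hP).
  have [s'] := monodromy_gauge hP g hs; rewrite gE => hs'.
  exact: flat_torsor_iso_sym (monodromy_iso hP hrho' hs').
have [s hs] := iso_monodromy hP' hrho iso.
have [s' hs'] := iso_monodromy hP' hrho' (flat_torsor_iso_refl hP').
have [g ->] := monodromy_unique hP' hs hs'.
by rewrite cohomology_class_gauge.
Qed.

Lemma flat_torsor_from_monodromy Q : is_flat_torsor Q ->
  exists2 rho, Z1 phi rho & flat_torsor_iso (P_rho phi rho) Q.
Proof.
move=> hQ; have [s fs] := exists_flat_section hQ.
have [rho hs] := exists_monodromy hQ fs.
have hrho := monodromy_Z1 hQ hs.
by have iso := monodromy_iso hQ hrho hs; exists rho.
Qed.

Definition class_to_torsors (c : set (deck p -> G)) :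
    flat_torsor_data GG -> Prop :=
  fun Q => exists2 rho, Z1 phi rho /\ c = cohomology_class phi rho &
    iso_class (P_rho phi rho) Q.

Lemma class_to_torsorsE rho : Z1 phi rho ->
  class_to_torsors (cohomology_class phi rho) = iso_class (P_rho phi rho).
Proof.
move=> hrho; apply/funext => Q; apply/propext; split; last by exists rho.
move=> [rho' [hrho' /cohomologous_iso-/(_ hrho hrho') iso]].
have hP := P_rho_flat_torsor hrho; have hP' := P_rho_flat_torsor hrho'.
by rewrite (iso_class_eq hP hP' iso).
Qed.

Lemma class_to_torsors_bij :
  bijection_onto (H1 phi) (@iso_classes R X G GG) class_to_torsors.
Proof.
split.
- move=> _ [rho hrho <-]; rewrite class_to_torsorsE //.
  by exists (P_rho phi rho); first exact: P_rho_flat_torsor.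
- move=> _ _ [rho hrho <-] [rho' hrho' <-]; rewrite !class_to_torsorsE // => e.
  apply/cohomologous_iso => //.
  have hP' := P_rho_flat_torsor hrho'.
  have : iso_class (P_rho phi rho') (P_rho phi rho').
    by split=> //; exact: flat_torsor_iso_refl.
  by rewrite -e => -[].
- move=> _ [Q hQ ->]; have [rho hrho iso] := flat_torsor_from_monodromy hQ.
  exists (cohomology_class phi rho); first by exists rho.
  rewrite class_to_torsorsE //.
  exact: iso_class_eq (P_rho_flat_torsor hrho) hQ iso.
Qed.

End FlatTorsors.

Theorem theorem4p8 (R : realType) (X Xt : charted_space R) (p : Xt -> X)
    (G : lie_group R) (phi : deck p -> G -> G)
    (hX : complex_manifold X) (cX : nonempty_connected X)
    (hp : universal_covering p)
    (hG : complex_lie_group G)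
    (hphi : aut_morphism phi) :
  exists Phi : set (deck p -> G) -> (flat_torsor_data (G_phi phi) -> Prop),
    (forall rho, Z1 phi rho ->
       Phi (cohomology_class phi rho) = iso_class (P_rho phi rho)) /\
    bijection_onto (H1 phi) (@iso_classes R X G (G_phi phi)) Phi.
Proof.
exists (@class_to_torsors R X Xt p G phi); split.
  exact: class_to_torsorsE.
exact: class_to_torsors_bij.
Qed.
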